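(* Let $n\ge 3$ be an odd integer and let $(\mathcal U,\mathcal T,\mathcal V)$ be a recollement of compactly generated triangulated categories with functors $\mathsf q,\mathsf p:\mathcal T\to\mathcal U$, $\mathsf i:\mathcal U\to\mathcal T$, $\mathsf l,\mathsf r:\mathcal V\to\mathcal T$, $\mathsf e:\mathcal T\to\mathcal V$. The following statements are equivalent. (i) The recollement $(\mathcal U,\mathcal T,\mathcal V)$ admits a ladder of height $n$ going upwards (with additional functors $\mathsf q^1,\dots,\mathsf q^{n-1}$ and $\mathsf l^1,\dots,\mathsf l^{n-1}$). (ii) There are functors $\mathsf q^1,\mathsf q^3,\dots,\mathsf q^{n-2}:\mathcal U\to\mathcal T$ and $\mathsf q^2,\mathsf q^4,\dots,\mathsf q^{n-1}:\mathcal T\to\mathcal U$ such that $(\mathsf q^{n-1},\mathsf q^{n-2}),\dots,(\mathsf q^2,\mathsf q^1),(\mathsf q^1,\mathsf q)$ are adjoint pairs. (In particular, the functors $\mathsf q,\mathsf q^1,\dots,\mathsf q^{n-1}$ then preserve compact objects.) (iii) There are functors $\mathsf l^1,\mathsf l^3,\dots,\mathsf l^{n-2}:\mathcal T\to\mathcal V$ and $\mathsf l^2,\mathsf l^4,\dots,\mathsf l^{n-1}:\mathcal V\to\mathcal T$ such that $(\mathsf l^{n-1},\mathsf l^{n-2}),\dots,(\mathsf l^2,\mathsf l^1),(\mathsf l^1,\mathsf l)$ are adjoint pairs. (In particular, the functors $\mathsf l,\mathsf l^1,\dots,\mathsf l^{n-1}$ then preserve compact objects.) (iv) The recollement $(\mathcal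 U,\mathcal T,\mathcal V)$ induces a recollement $(\mathcal U^{\mathsf c},\mathcal T^{\mathsf c},\mathcal V^{\mathsf c})$ which admits a ladder of height $n-2$ going upwards; here the induced recollement is one whose bottom row consists of the restrictions $\mathsf q:\mathcal T^{\mathsf c}\to\mathcal U^{\mathsf c}$ and $\mathsf l:\mathcal V^{\mathsf c}\to\mathcal T^{\mathsf c}$, that is, a recollement with adjoint triples $(\mathsf q^2,\mathsf q^1,\mathsf q)$ and $(\mathsf l^2,\mathsf l^1,\mathsf l)$, where $\mathsf q^1:\mathcal U^{\mathsf c}\to\mathcal T^{\mathsf c}$ is the inclusion functor and $\mathsf l^1:\mathcal T^{\mathsf c}\to\mathcal V^{\mathsf c}$ the quotient functor. (v) There is a sequence of triangulated subcategories $\mathcal X_{n+2},\mathcal X_{n+1},\dots,\mathcal X_1$ of $\mathcal T$ with $\mathcal X_3=\mathsf l(\mathcal V)$, $\mathcal X_2=\mathsf i(\mathcal U)$, $\mathcal X_1=\mathsf r(\mathcal V)$ such that $(\mathcal X_{j+2},\mathcal X_{j+1},\mathcal X_{j})$ is a TTF-triple in $\mathcal T$ for all $1\le j\le n$. (vi) There is a sequence of triangulated subcategories $\mathcal X_{n+2},\mathcal X_{n+1},\dots,\mathcal X_3$ of $\mathcal T$ with $\mathcal X_3=\mathsf l(\mathcal V)$ such that $(\mathcal X_{j+2}\cap\mathcal T^{\mathsf c},\mathcal X_{j+1}\cap\mathcal T^{\mathsf c},\mathcal X_{j}\cap\mathcal T^{\mathsf c})$ is a TTF-triple in $\mathcal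 T^{\mathsf c}$ for all $3\le j\le n$.
   Context: Recollements. A recollement $(\mathcal U,\mathcal T,\mathcal V)$ of triangulated categories consists of triangle functors $\mathsf i:\mathcal U\to\mathcal T$, $\mathsf e:\mathcal T\to\mathcal V$, $\mathsf q,\mathsf p:\mathcal T\to\mathcal U$, $\mathsf l,\mathsf r:\mathcal V\to\mathcal T$ such that $(\mathsf q,\mathsf i,\mathsf p)$ and $(\mathsf l,\mathsf e,\mathsf r)$ are adjoint triples (each functor left adjoint to the next), $\mathsf i,\mathsf l,\mathsf r$ are fully faithful, and the essential image of $\mathsf i$ equals $\ker\mathsf e$. For a functor $F:\mathcal C\to\mathcal T$, $F(\mathcal C)$ denotes its essential image. Compact generation. Let $\mathcal T$ be a triangulated category with small coproducts. An object $X$ is compact if $\mathrm{Hom}_{\mathcal T}(X,-)$ preserves coproducts; $\mathcal T^{\mathsf c}$ is the full subcategory of compact objects. $\mathcal T$ is compactly generated if $\mathcal T^{\mathsf c}$ is skeletally small and $\mathrm{Hom}_{\mathcal T}(X,Y)=0$ for all $X\in\mathcal T^{\mathsf c}$ implies $Y=0$. A recollement of compactly generated triangulated categories is one in which $\mathcal U,\mathcal T,\mathcal V$ are all compactly generated; in that case $\mathsf q$ and $\mathsf l$ preserve compact objects. Ladders going upwards. A ladder of height $m$ going upwards for a recollement $(\mathcal U,\mathcal T,\mathcal V)$ is an extension of it by triangle functors $\mathsf q^1,\dots,\mathsf q^{m-1}$ and $\mathsf l^1,\dots,\mathsf l^{m-1}$, with $\mathsf q^j:\mathcal U\to\mathcal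 T$ and $\mathsf l^j:\mathcal T\to\mathcal V$ for $j$ odd, $\mathsf q^j:\mathcal T\to\mathcal U$ and $\mathsf l^j:\mathcal V\to\mathcal T$ for $j$ even, such that in the list of rows (from top to bottom) $(\mathsf q^{m-1},\mathsf l^{m-1}),\dots,(\mathsf q^1,\mathsf l^1),(\mathsf q,\mathsf l),(\mathsf i,\mathsf e),(\mathsf p,\mathsf r)$ any three consecutive rows form a recollement (alternately of shape $(\mathcal U,\mathcal T,\mathcal V)$ and $(\mathcal V,\mathcal T,\mathcal U)$); in particular each functor in a column is left adjoint to the next one below it. Height one means just the recollement itself. TTF-triples. A stable t-structure (torsion pair of triangulated subcategories) in $\mathcal T$ is a pair $(\mathcal X,\mathcal Y)$ of full triangulated subcategories closed under isomorphisms, with $\mathrm{Hom}_{\mathcal T}(\mathcal X,\mathcal Y)=0$, such that each $T\in\mathcal T$ sits in a triangle $X\to T\to Y\to X[1]$ with $X\in\mathcal X$, $Y\in\mathcal Y$. A TTF-triple is a triple $(\mathcal X,\mathcal Y,\mathcal Z)$ such that $(\mathcal X,\mathcal Y)$ and $(\mathcal Y,\mathcal Z)$ are stable t-structures. *)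

(* Defs.v *)
From HB Require Import structures.
From mathcomp Require Import all_boot ssralg ring_quotient.
From mathcomp Require Import boolp.

Set Implicit Arguments.
Unset Strict Implicit.
Unset Printing Implicit Defensive.

Import GRing.Theory.

Declare Scope category_scope.
Delimit Scope category_scope with cat.
Local Open Scope category_scope.
Local Open Scope ring_scope.

(* MathComp, with the classical axioms of [boolp].  [Set] plays the role of the
   universe of small sets: morphisms form small sets and coproducts are indexed
   by small sets, whereas the objects live in a strictly larger universe. *)

Record category := Category {
  ob :> Type;
  hom : ob -> ob -> Set;
  idm : forall X, hom X X;
  comp : forall X Y Z, hom Y Z -> hom X Y -> hom X Z;
  comp_idl : forall X Y (f : hom X Y), comp (idm Y) f = f;
  comp_idr : forall X Y (f : hom X Y), comp f (idm X) = f;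
  compA : forall W X Y Z (h : hom Y Z) (g : hom X Y) (f : hom W X),
    comp h (comp g f) = comp (comp h g) f
}.

Notation "g \oc f" := (comp g f) (at level 40, left associativity)
  : category_scope.
Arguments idm {c} X.
Arguments compA {c W X Y Z}.

Definition is_iso (C : category) (X Y : C) (f : hom X Y) : Prop :=
  exists g : hom Y X, g \oc f = idm X /\ f \oc g = idm Y.

Definition isomorphic (C : category) (X Y : C) : Prop :=
  exists f : hom X Y, is_iso f.

Record functor (C D : category) := Functor {
  fobj :> C -> D;
  fmap : forall X Y, hom X Y -> hom (fobj X) (fobj Y);
  fmap_id : forall X, fmap (idm X) = idm (fobj X);
  fmap_comp : forall X Y Z (g : hom Y Z) (f : hom X Y),
    fmap (g \oc f) = fmap g \oc fmap f
}.
Arguments fmap {C D} f {X Y} : rename.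

Definition functor_id (C : category) : functor C C :=
  @Functor C C id (fun _ _ => id) (fun _ => erefl) (fun _ _ _ _ _ => erefl).

Lemma functor_comp_id (B C D : category) (G : functor C D) (F : functor B C) X :
  fmap G (fmap F (idm X)) = idm (G (F X)).
Proof. by rewrite !fmap_id. Qed.

Lemma functor_comp_comp (B C D : category) (G : functor C D) (F : functor B C)
    X Y Z (g : hom Y Z) (f : hom X Y) :
  fmap G (fmap F (g \oc f)) = fmap G (fmap F g) \oc fmap G (fmap F f).
Proof. by rewrite !fmap_comp. Qed.

Definition functor_comp (B C D : category) (G : functor C D) (F : functor B C) :
    functor B D :=
  @Functor B D (fun X => G (F X)) (fun _ _ f => fmap G (fmap F f))
    (functor_comp_id G F) (functor_comp_comp G F).

Definition naturally_isomorphic (C D : category) (F G : functor C D) : Prop :=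
  exists a : forall X, hom (F X) (G X),
    (forall X, is_iso (a X)) /\
    (forall X Y (f : hom X Y), a Y \oc fmap F f = fmap G f \oc a X).

Definition is_equivalence (C D : category) (F : functor C D) : Prop :=
  exists G : functor D C,
    naturally_isomorphic (functor_comp G F) (functor_id C) /\
    naturally_isomorphic (functor_comp F G) (functor_id D).

Definition fully_faithful (C D : category) (F : functor C D) : Prop :=
  forall X Y, bijective (@fmap C D F X Y).

Definition ess_image (C D : category) (F : functor C D) (Y : D) : Prop :=
  exists X, isomorphic (F X) Y.

Definition adjoint (C D : category) (F : functor C D) (G : functor D C) : Prop :=
  exists phi : forall X Y, hom (F X) Y -> hom X (G Y),
    (forall X Y, bijective (@phi X Y)) /\
    (forall X' X Y Y' (h : hom X' X) (f : hom (F X) Y) (g : hom Y Y'),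
       phi X' Y' (g \oc f \oc fmap F h) = fmap G g \oc phi X Y f \oc h).

Definition is_coproduct (C : category) (I : Set) (Y : I -> C) (P : C)
    (inj : forall i, hom (Y i) P) : Prop :=
  forall (Z : C) (f : forall i, hom (Y i) Z),
    exists! h : hom P Z, forall i, h \oc inj i = f i.

Definition has_small_coproducts (C : category) : Prop :=
  forall (I : Set) (Y : I -> C), exists P (inj : forall i, hom (Y i) P),
    is_coproduct inj.

Definition skeletally_small (C : category) : Prop :=
  exists (I : Set) (G : I -> C), forall X : C, exists i, isomorphic (G i) X.

Record zmod_category := ZmodCategory {
  zmod_cat :> category;
  hom_zmod : forall X Y : zmod_cat, GRing.Zmodule (hom X Y)
}.

HB.instance Definition _ (C : zmod_category) (X Y : C) := hom_zmod X Y.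

Record preadditive := Preadditive {
  pre_cat :> zmod_category;
  compDl : forall (X Y Z : pre_cat) (g g' : hom Y Z) (f : hom X Y),
    (g + g') \oc f = g \oc f + g' \oc f;
  compDr : forall (X Y Z : pre_cat) (g : hom Y Z) (f f' : hom X Y),
    g \oc (f + f') = g \oc f + g \oc f'
}.

Definition postcomp (C : preadditive) (X Y Z : C) (g : hom Y Z) (f : hom X Y) :
  hom X Z := g \oc f.

Lemma comp0l (C : preadditive) (X Y Z : C) (f : hom X Y) :
  (0 : hom Y Z) \oc f = 0.
Proof. by apply: (addIr (0 \oc f)); rewrite -compDl !add0r. Qed.

Lemma comp0r (C : preadditive) (X Y Z : C) (g : hom Y Z) :
  g \oc (0 : hom X Y) = 0.
Proof. by apply: (addIr (g \oc 0)); rewrite -compDr !add0r. Qed.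

Lemma compNl (C : preadditive) (X Y Z : C) (g : hom Y Z) (f : hom X Y) :
  (- g) \oc f = - (g \oc f).
Proof. by apply: (addIr (g \oc f)); rewrite -compDl !addNr comp0l. Qed.

Lemma compNr (C : preadditive) (X Y Z : C) (g : hom Y Z) (f : hom X Y) :
  g \oc (- f) = - (g \oc f).
Proof. by apply: (addIr (g \oc f)); rewrite -compDr !addNr comp0r. Qed.

Lemma compBl (C : preadditive) (X Y Z : C) (g g' : hom Y Z) (f : hom X Y) :
  (g - g') \oc f = g \oc f - g' \oc f.
Proof. by rewrite compDl compNl. Qed.

Lemma compBr (C : preadditive) (X Y Z : C) (g : hom Y Z) (f f' : hom X Y) :
  g \oc (f - f') = g \oc f - g \oc f'.
Proof. by rewrite compDr compNr. Qed.

HB.instance Definition _ (C : preadditive) (X Y Z : C) (g : hom Y Z) :=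
  GRing.isZmodMorphism.Build (hom X Y) (hom X Z) (postcomp g) (compBr g).

Lemma compMnr (C : preadditive) (X Y Z : C) (g : hom Y Z) (f : hom X Y) n :
  g \oc (f *+ n) = (g \oc f) *+ n.
Proof. exact: (raddfMn (postcomp g)). Qed.

Lemma comp_suml (C : preadditive) (X Y Z : C) (I : Type) (s : seq I)
    (g : I -> hom Y Z) (f : hom X Y) :
  (\sum_(i <- s) g i) \oc f = \sum_(i <- s) (g i \oc f).
Proof.
by elim/big_rec2: _ => [|i x y _ <-]; rewrite ?comp0l ?compDl.
Qed.

Lemma comp_sumr (C : preadditive) (X Y Z : C) (I : Type) (s : seq I)
    (g : hom Y Z) (f : I -> hom X Y) :
  g \oc (\sum_(i <- s) f i) = \sum_(i <- s) (g \oc f i).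
Proof.
by elim/big_rec2: _ => [|i x y _ <-]; rewrite ?comp0r ?compDr.
Qed.

Definition is_zero (C : preadditive) (X : C) : Prop :=
  (forall Y (f : hom X Y), f = 0) /\ (forall Y (f : hom Y X), f = 0).

Definition is_biproduct (C : preadditive) (X Y P : C) (i1 : hom X P)
    (i2 : hom Y P) (p1 : hom P X) (p2 : hom P Y) : Prop :=
  [/\ p1 \oc i1 = idm X, p2 \oc i2 = idm Y, p1 \oc i2 = 0, p2 \oc i1 = 0
    & i1 \oc p1 + i2 \oc p2 = idm P].

Definition is_additive_functor (C D : preadditive) (F : functor C D) : Prop :=
  forall (X Y : C) (f g : hom X Y), fmap F (f + g) = fmap F f + fmap F g.

Record triangulated := Triangulated {
  tri_pre :> preadditive;
  tri_zero : exists Z : tri_pre, is_zero Z;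
  tri_biproduct : forall X Y : tri_pre, exists P (i1 : hom X P) (i2 : hom Y P)
    (p1 : hom P X) (p2 : hom P Y), is_biproduct i1 i2 p1 p2;
  shift : functor tri_pre tri_pre;
  shift_equivalence : is_equivalence shift;
  shift_additive : is_additive_functor shift;
  dist : forall X Y Z : tri_pre,
    hom X Y -> hom Y Z -> hom Z (shift X) -> Prop;
  dist_iso : forall (X Y Z X' Y' Z' : tri_pre)
    (u : hom X Y) (v : hom Y Z) (w : hom Z (shift X))
    (u' : hom X' Y') (v' : hom Y' Z') (w' : hom Z' (shift X'))
    (a : hom X X') (b : hom Y Y') (c : hom Z Z'),
    dist u v w -> is_iso a -> is_iso b -> is_iso c ->
    b \oc u = u' \oc a -> c \oc v = v' \oc b -> fmap shift a \oc w = w' \oc c ->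
    dist u' v' w';
  dist_id : forall (X Z : tri_pre), is_zero Z ->
    dist (idm X) (0 : hom X Z) (0 : hom Z (shift X));
  dist_cone : forall (X Y : tri_pre) (u : hom X Y),
    exists Z (v : hom Y Z) (w : hom Z (shift X)), dist u v w;
  dist_rotate : forall (X Y Z : tri_pre)
    (u : hom X Y) (v : hom Y Z) (w : hom Z (shift X)),
    dist u v w <-> dist v w (- fmap shift u : hom (shift X) (shift Y));
  dist_fill : forall (X Y Z X' Y' Z' : tri_pre)
    (u : hom X Y) (v : hom Y Z) (w : hom Z (shift X))
    (u' : hom X' Y') (v' : hom Y' Z') (w' : hom Z' (shift X'))
    (a : hom X X') (b : hom Y Y'),
    dist u v w -> dist u' v' w' -> b \oc u = u' \oc a ->
    exists c : hom Z Z', c \oc v = v' \oc b /\ fmap shift a \oc w = w' \oc c;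
  dist_octahedron : forall (X Y Z Z' X' Y' : tri_pre)
    (u : hom X Y) (v : hom Y Z)
    (a : hom Y Z') (a' : hom Z' (shift X))
    (b : hom Z X') (b' : hom X' (shift Y))
    (c : hom Z Y') (c' : hom Y' (shift X)),
    dist u a a' -> dist v b b' -> dist (v \oc u) c c' ->
    exists (m : hom Z' Y') (n : hom Y' X'),
      [/\ dist m n (fmap shift a \oc b'),
          m \oc a = c \oc v, c' \oc m = a',
          n \oc c = b & b' \oc n = fmap shift u \oc c']
}.
Arguments shift {t}.
Arguments dist {t X Y Z}.

Record triangulated_subcategory (T : triangulated) (P : T -> Prop) : Prop :=
  TriangulatedSubcategory {
    sub_zero : forall X, is_zero X -> P X;
    sub_biproduct : forall (X Y B : T) (i1 : hom X B) (i2 : hom Y B)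
      (p1 : hom B X) (p2 : hom B Y),
      is_biproduct i1 i2 p1 p2 -> P X -> P Y -> P B;
    sub_iso : forall X Y, isomorphic X Y -> P X -> P Y;
    sub_shift : forall X, P X <-> P (shift X);
    sub_cone : forall (X Y Z : T) (u : hom X Y) (v : hom Y Z)
      (w : hom Z (shift X)), dist u v w -> P X -> P Y -> P Z
  }.

Section FullSubcategory.
Variables (T : triangulated) (P : T -> Prop).
Hypothesis PT : triangulated_subcategory P.

Definition full_sub : category :=
  @Category {X : T | P X} (fun X Y => hom (sval X) (sval Y))
    (fun X => idm (sval X)) (fun _ _ _ g f => g \oc f)
    (fun _ _ => @comp_idl T _ _) (fun _ _ => @comp_idr T _ _)
    (fun _ _ _ _ => @compA T _ _ _ _).

Definition full_sub_pre : preadditive :=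
  @Preadditive
    (@ZmodCategory full_sub (fun X Y => hom_zmod (sval X) (sval Y)))
    (fun _ _ _ => @compDl T _ _ _) (fun _ _ _ => @compDr T _ _ _).

Definition full_sub_shift : functor full_sub full_sub :=
  @Functor full_sub full_sub
    (fun X => exist P (shift (sval X)) ((sub_shift PT _).1 (svalP X)))
    (fun X Y f => fmap shift f)
    (fun X => fmap_id shift (sval X)) (fun _ _ _ => @fmap_comp _ _ shift _ _ _).

Lemma full_sub_equivalence : is_equivalence full_sub_shift.
Proof.
have [G [[a [aI aN]] [b [bI bN]]]] := shift_equivalence T.
have PG X : P X -> P (G X).
  move=> PX; apply/(sub_shift PT); apply: (sub_iso PT) PX.
  by have [g [gb bg]] := bI X; exists g, (b X).
pose G' : functor full_sub full_sub := @Functor full_sub full_sub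
  (fun X => exist P (G (sval X)) (PG _ (svalP X))) (fun X Y f => fmap G f)
  (fun X => fmap_id G (sval X)) (fun _ _ _ => @fmap_comp _ _ G _ _ _).
exists G'; split.
  exists (fun X => a (sval X)); split=> [X|X Y f]; first exact: aI.
  exact: (aN _ _ f).
exists (fun X => b (sval X)); split=> [X|X Y f]; first exact: bI.
exact: (bN _ _ f).
Qed.

Lemma full_sub_is_zero (X : full_sub_pre) : is_zero (sval X) -> is_zero X.
Proof. by case=> h1 h2; split=> Y f; [apply: h1|apply: h2]. Qed.

Lemma full_sub_zero : exists Z : full_sub_pre, is_zero Z.
Proof.
have [Z Z0] := tri_zero T.
by exists (exist P Z (sub_zero PT Z0)); apply: full_sub_is_zero.
Qed.

Lemma full_sub_biproduct (X Y : full_sub_pre) :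
  exists B (i1 : hom X B) (i2 : hom Y B) (p1 : hom B X) (p2 : hom B Y),
    is_biproduct i1 i2 p1 p2.
Proof.
have [B [i1 [i2 [p1 [p2 h]]]]] := tri_biproduct (sval X) (sval Y).
by exists (exist P B (sub_biproduct PT h (svalP X) (svalP Y))), i1, i2, p1, p2.
Qed.

Lemma full_sub_shift_additive :
  @is_additive_functor full_sub_pre full_sub_pre full_sub_shift.
Proof. move=> X Y f g; exact: (@shift_additive T). Qed.

Definition full_sub_dist (X Y Z : full_sub_pre) (u : hom X Y) (v : hom Y Z)
  (w : hom Z (full_sub_shift X)) : Prop := @dist T _ _ _ u v w.

Lemma full_sub_dist_id (X Z : full_sub_pre) : is_zero Z ->
  full_sub_dist (idm X) (0 : hom X Z) (0 : hom Z (full_sub_shift X)).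
Proof.
case=> Z1 _; apply: dist_id.
have idZ : idm (sval Z) = 0 := Z1 Z (idm Z).
split=> Y f.
  by rewrite -(comp_idr f) idZ comp0r.
by rewrite -(comp_idl f) idZ comp0l.
Qed.

Lemma full_sub_dist_cone (X Y : full_sub_pre) (u : hom X Y) :
  exists Z (v : hom Y Z) (w : hom Z (full_sub_shift X)), full_sub_dist u v w.
Proof.
have [Z [v [w d]]] := dist_cone (u : hom (sval X) (sval Y)).
by exists (exist P Z (sub_cone PT d (svalP X) (svalP Y))), v, w.
Qed.

Definition full_sub_tri : triangulated :=
  @Triangulated full_sub_pre full_sub_zero full_sub_biproduct full_sub_shift
    full_sub_equivalence full_sub_shift_additive full_sub_dist
    (fun _ _ _ _ _ _ => @dist_iso T _ _ _ _ _ _) full_sub_dist_id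
    full_sub_dist_cone (fun _ _ _ => @dist_rotate T _ _ _)
    (fun _ _ _ _ _ _ => @dist_fill T _ _ _ _ _ _)
    (fun _ _ _ _ _ _ => @dist_octahedron T _ _ _ _ _ _).

End FullSubcategory.

(* [B] with the additive maps [u i] is the coproduct of the [A i] in the
   category of abelian groups. *)
Definition is_ab_coproduct (I : Set) (A : I -> zmodType) (B : zmodType)
    (u : forall i, {additive A i -> B}) : Prop :=
  forall (C : zmodType) (phi : forall i, {additive A i -> C}),
    exists psi : {additive B -> C}, (forall i a, psi (u i a) = phi i a) /\
      (forall psi' : {additive B -> C},
         (forall i a, psi' (u i a) = phi i a) -> psi' =1 psi).

Definition compact (T : preadditive) (X : T) : Prop :=
  forall (I : Set) (Y : I -> T) (P : T) (inj : forall i, hom (Y i) P),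
    is_coproduct inj ->
    is_ab_coproduct
      (fun i => postcomp (inj i) : {additive hom X (Y i) -> hom X P}).

Definition preserves_coproducts (C D : category) (F : functor C D) : Prop :=
  forall (I : Set) (Y : I -> C) (P : C) (inj : forall i, hom (Y i) P),
    is_coproduct inj -> is_coproduct (fun i => fmap F (inj i)).

Definition preserves_compact (C D : preadditive) (F : functor C D) : Prop :=
  forall X : C, compact X -> compact (F X).

Section CompactFactorization.
Variables (C : preadditive) (I : Set) (Y : I -> C) (P : C).
Variable inj : forall i, hom (Y i) P.

Definition fin_factor (X : C) (f : hom X P) : Prop :=
  exists (s : seq {classic I}) (g : forall i, hom X (Y i)),
    f = \sum_(i <- s) inj i \oc g i.

Lemma fin_factor0 X : fin_factor (0 : hom X P).
Proof. by exists [::], (fun => 0); rewrite big_nil. Qed.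

Lemma fin_factor_one X i (g : hom X (Y i)) : fin_factor (inj i \oc g).
Proof.
exists [:: i], (fun j => if pselect (i = j) is left e
                       then eq_rect i (fun j => hom X (Y j)) g j e else 0).
rewrite big_seq1; case: pselect => // e.
by rewrite (Prop_irrelevance e erefl).
Qed.

Hypothesis injP : is_coproduct inj.

Lemma coproduct_projections : exists pr : forall j, hom P (Y j),
  (forall j, pr j \oc inj j = idm (Y j)) /\
  (forall i j, i <> j -> pr j \oc inj i = 0).
Proof.
pose d j i : hom (Y i) (Y j) := if pselect (i = j) is left e
  then eq_rect i (fun k => hom (Y i) (Y k)) (idm (Y i)) j e else 0.
have pP j : exists h : hom P (Y j), forall i, h \oc inj i = d j i.
  by have [h [hP _]] := injP (d j); exists h.
exists (fun j => sval (cid (pP j))); split=> [j|i j ij];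
  case: cid => h /= ->; rewrite /d; case: pselect => // e.
by rewrite (Prop_irrelevance e erefl).
Qed.

Variable pr : forall j, hom P (Y j).
Hypothesis pr_inj : forall j, pr j \oc inj j = idm (Y j).
Hypothesis pr_inj0 : forall i j, i <> j -> pr j \oc inj i = 0.

Definition supports (X : C) (s : seq {classic I}) (f : hom X P) : Prop :=
  (forall i : {classic I}, i \notin s -> pr i \oc f = 0) /\
  f = \sum_(i <- s) inj i \oc (pr i \oc f).

Lemma fin_factor_supports X (f : hom X P) :
  fin_factor f -> exists s, uniq s /\ supports s f.
Proof.
case=> s [g ->]; exists (undup s); split; first exact: undup_uniq.
pose h (i : {classic I}) : hom X (Y i) := g i *+ count_mem i s.
have -> : \sum_(i <- s) inj i \oc g i = \sum_(i <- undup s) inj i \oc h i.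
  rewrite -big_undup_iterop_count; apply: eq_bigr => i _.
  by rewrite compMnr.
have prE (j : {classic I}) : pr j \oc (\sum_(i <- undup s) inj i \oc h i) =
    if j \in undup s then h j else 0.
  rewrite comp_sumr; case: ifPn => js.
    rewrite (bigD1_seq j) ?undup_uniq //= compA pr_inj comp_idl big1 ?addr0 //.
    by move=> i /eqP ij; rewrite compA pr_inj0 ?comp0l.
  rewrite big_seq big1 // => i /[dup] iS; rewrite compA pr_inj0 ?comp0l //.
  by move=> e; rewrite -e iS in js.
split=> [i iS|]; first by rewrite prE (negPf iS).
by apply: eq_big_seq => i iS; rewrite prE iS.
Qed.

Lemma supports_sum (A : zmodType) X (phi : forall i, {additive hom X (Y i) -> A})
    (s t : seq {classic I}) (f : hom X P) :
  uniq s -> uniq t -> (forall i, i \notin s -> pr i \oc f = 0) ->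
  (forall i, i \notin t -> pr i \oc f = 0) ->
  \sum_(i <- s) phi i (pr i \oc f) = \sum_(i <- t) phi i (pr i \oc f).
Proof.
wlog st : s t / {subset s <= t} => [H|] us ut s0 t0.
  have st0 i : i \notin undup (s ++ t) -> pr i \oc f = 0.
    by rewrite mem_undup mem_cat negb_or => /andP[/s0].
  rewrite (H s (undup (s ++ t))) ?undup_uniq //; last first.
    by move=> i iS; rewrite mem_undup mem_cat iS.
  by rewrite (H t (undup (s ++ t))) ?undup_uniq // => i iS;
    rewrite mem_undup mem_cat iS orbT.
rewrite [RHS](bigID (fun i => i \in s)) /= [X in _ + X]big1 ?addr0; last first.
  by move=> i /s0 ->; rewrite raddf0.
rewrite -[RHS]big_filter; apply: perm_big; apply: uniq_perm; rewrite ?filter_uniq //.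
by move=> i; rewrite mem_filter; case: (boolP (i \in s)) => // /st ->.
Qed.

Lemma supports_sub X (s t : seq {classic I}) (f g : hom X P) :
  (forall i, i \notin s -> pr i \oc f = 0) ->
  (forall i, i \notin t -> pr i \oc g = 0) ->
  forall i, i \notin undup (s ++ t) ->
    [/\ pr i \oc f = 0, pr i \oc g = 0 & pr i \oc (f - g) = 0].
Proof.
move=> s0 t0 i; rewrite mem_undup mem_cat negb_or => /andP[/s0 fi /t0 gi].
by rewrite compBr fi gi subr0.
Qed.

Lemma fin_factor_ab_coproduct X : (forall f : hom X P, fin_factor f) ->
  is_ab_coproduct
    (fun i => postcomp (inj i) : {additive hom X (Y i) -> hom X P}).
Proof.
move=> fin A phi.
have supp f := fin_factor_supports (fin f).
pose s f := sval (cid (supp f)).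
have us f : uniq (s f) by rewrite /s; case: cid => ? [].
have sf f : supports (s f) f by rewrite /s; case: cid => ? [].
pose psi f := \sum_(i <- s f) phi i (pr i \oc f).
have psiE f (t : seq {classic I}) : uniq t -> (forall i, i \notin t -> pr i \oc f = 0) ->
    psi f = \sum_(i <- t) phi i (pr i \oc f).
  by move=> ut t0; apply: supports_sum => //; case: (sf f).
have psiB : {morph psi : f g / f - g}.
  move=> f g; have H := supports_sub (sf f).1 (sf g).1.
  rewrite !(@psiE _ (undup (s f ++ s g))) ?undup_uniq //; try by move=> i /H[].
  by rewrite -sumrB; apply: eq_bigr => i _; rewrite compBr raddfB.
pose psiM := GRing.isZmodMorphism.Build _ _ psi psiB.
pose psiA : {additive hom X P -> A} := HB.pack psi psiM.
exists psiA; split=> [i a|psi' psi'E f].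
  rewrite /= (@psiE _ [:: i]) ?big_seq1 // => [|j].
    by rewrite /postcomp compA pr_inj comp_idl.
  by rewrite inE => /eqP ji; rewrite /postcomp compA pr_inj0 ?comp0l // => /esym.
rewrite {1}(sf f).2 raddf_sum /=; apply: eq_bigr => i _.
by rewrite -psi'E.
Qed.

End CompactFactorization.

Section FinFactorQuotient.
Variables (C : preadditive) (I : Set) (Y : I -> C) (P : C).
Variable inj : forall i, hom (Y i) P.
Hypothesis injP : is_coproduct inj.
Variable X : C.

Lemma fin_factorB (f g : hom X P) :
  fin_factor inj f -> fin_factor inj g -> fin_factor inj (f - g).
Proof.
have [pr [prI prI0]] := coproduct_projections injP.
move=> /(fin_factor_supports prI prI0)[s [us [s0 fE]]].
move=> /(fin_factor_supports prI prI0)[t [ut [t0 gE]]].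
pose r := undup (s ++ t).
exists r, (fun i => pr i \oc (f - g)).
have rE (h : hom X P) (u : seq {classic I}) : uniq u -> {subset u <= r} ->
    (forall i, i \notin u -> pr i \oc h = 0) ->
    h = \sum_(i <- u) inj i \oc (pr i \oc h) ->
    h = \sum_(i <- r) inj i \oc (pr i \oc h).
  move=> uu ur u0 {1}->.
  apply: (supports_sum (fun i => postcomp (inj i)
    : {additive hom X (Y i) -> hom X P}) uu (undup_uniq _) u0).
  by move=> i /(contra (ur i)) /u0.
rewrite {1}(rE f s) //; last by move=> i iS; rewrite mem_undup mem_cat iS.
rewrite {1}(rE g t) //; last by move=> i iS; rewrite mem_undup mem_cat iS orbT.
by rewrite -sumrB; apply: eq_bigr => i _; rewrite !compBr.
Qed.

Definition fin_pred : {pred hom X P} := fun f => `[< fin_factor inj f >].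

Lemma fin_pred_closed : zmod_closed fin_pred.
Proof.
split; first exact/asboolP/fin_factor0.
by move=> f g /asboolP ff /asboolP fg; apply/asboolP/fin_factorB.
Qed.

HB.instance Definition _ :=
  GRing.isZmodClosed.Build (hom X P) fin_pred fin_pred_closed.

Lemma ab_coproduct_fin_factor :
  is_ab_coproduct
    (fun i => postcomp (inj i) : {additive hom X (Y i) -> hom X P}) ->
  forall f : hom X P, fin_factor inj f.
Proof.
move=> abP f.
pose pi : {additive hom X P -> Quotient.quot fin_pred} :=
  \pi_(Quotient.quot fin_pred)%qT.
have pi0 i (a : hom X (Y i)) : pi (postcomp (inj i) a) = 0.
  rewrite /pi -(raddf0 pi); apply/eqP; rewrite -Quotient.idealrBE subr0.
  exact/asboolP/fin_factor_one.
have [psi [_ psiU]] := abP (Quotient.quot fin_pred) (fun i => \0).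
have := psiU pi pi0 f; rewrite -(psiU \0 (fun _ _ => erefl) f) /= -(raddf0 pi).
by move=> /eqP; rewrite -Quotient.idealrBE subr0 => /asboolP.
Qed.

End FinFactorQuotient.

Lemma compactP (C : preadditive) (X : C) :
  compact X <->
  forall (I : Set) (Y : I -> C) (P : C) (inj : forall i, hom (Y i) P),
    is_coproduct inj -> forall f : hom X P, fin_factor inj f.
Proof.
split=> [cX I Y P inj injP|H I Y P inj injP].
  move=> f; apply: (ab_coproduct_fin_factor injP); exact: cX injP.
have [pr [prI prI0]] := coproduct_projections injP.
by apply: (fin_factor_ab_coproduct prI prI0); exact: H injP.
Qed.

Lemma adjoint_preserves_coproducts (C D : category) (F : functor C D)
    (G : functor D C) : adjoint F G -> preserves_coproducts F.
Proof.
move=> [phi [phiB phiN]] I Y P inj injP Z f.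
have phiN' i (h : hom (F P) Z) :
    phi _ _ (h \oc fmap F (inj i)) = phi _ _ h \oc inj i.
  have := phiN _ _ _ _ (inj i) h (idm Z).
  by rewrite comp_idl fmap_id comp_idl.
have [psi phiK psiK] := phiB P Z.
have [h [hP hU]] := injP (G Z) (fun i => phi _ _ (f i)).
exists (psi h); split=> [i|h' h'P].
  by apply: (bij_inj (phiB _ _)); rewrite phiN' psiK hP.
by rewrite (hU (phi _ _ h')) ?phiK // => i; rewrite -phiN' h'P.
Qed.

Lemma adjoint_preserves_compact (C D : preadditive) (F : functor C D)
    (G : functor D C) : adjoint F G -> preserves_coproducts G ->
  is_additive_functor F \/ is_additive_functor G -> preserves_compact F.
Proof.
move=> [phi [phiB phiN]] GP addFG X /compactP cX; apply/compactP.
move=> I Y P inj injP f.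
have phiNr Y1 Y2 (g : hom Y1 Y2) (h : hom (F X) Y1) :
    phi _ _ (g \oc h) = fmap G g \oc phi _ _ h.
  have := phiN _ _ _ _ (idm X) h g.
  by rewrite fmap_id !comp_idr.
have phiNl X1 X2 Z (g : hom X1 X2) (h : hom (F X2) Z) :
    phi _ _ (h \oc fmap F g) = phi _ _ h \oc g.
  have := phiN _ _ _ _ g h (idm Z).
  by rewrite comp_idl fmap_id comp_idl.
have phiD Z (g h : hom (F X) Z) : phi _ _ (g + h) = phi _ _ g + phi _ _ h.
  case: addFG => [addF|addG].
    have [eps _ epsK] := phiB (G Z) Z; have e := epsK (idm (G Z)).
    have phiE (k : hom (F X) Z) : k = eps (idm (G Z)) \oc fmap F (phi _ _ k).
      by apply: (bij_inj (phiB _ _)); rewrite phiNl e comp_idl.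
    rewrite {1}(phiE g) {1}(phiE h) -compDr -addF phiNl e comp_idl.
    by [].
  have phiE (k : hom (F X) Z) : phi _ _ k = fmap G k \oc phi _ _ (idm (F X)).
    by rewrite -phiNr comp_idr.
  by rewrite phiE addG compDl -!phiE.
have phi0 Z : phi X Z 0 = 0.
  by apply: (addIr (phi X Z 0)); rewrite -phiD !add0r.
have [s [g E]] := cX _ _ _ _ (GP _ _ _ _ injP) (phi _ _ f).
have gP i : exists k : hom (F X) (Y i), phi _ _ k = g i.
  by have [psi _ psiK] := phiB X (Y i); exists (psi (g i)).
pose k i := sval (cid (gP i)).
have kP i : phi _ _ (k i) = g i by rewrite /k; case: cid.
exists s, k; apply: (bij_inj (phiB _ _)); rewrite E.
rewrite (big_morph (phi X P) (phiD P) (phi0 P)).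
by apply: eq_bigr => i _; rewrite phiNr kP.
Qed.

Lemma retract_faithful (C D : category) (F : functor C D) (G : functor D C) :
  naturally_isomorphic (functor_comp G F) (functor_id C) ->
  forall X Y (f g : hom X Y), fmap F f = fmap F g -> f = g.
Proof.
move=> [a [aI aN]] X Y f g E; have [b [_ ab]] := aI X.
rewrite -[f]comp_idr -[g]comp_idr -ab !compA.
by have /= <- := aN _ _ f; have /= <- := aN _ _ g; rewrite E.
Qed.

Lemma quasi_inverse_adjoint (C D : category) (F : functor C D)
    (G : functor D C) :
  naturally_isomorphic (functor_comp G F) (functor_id C) ->
  naturally_isomorphic (functor_comp F G) (functor_id D) -> adjoint F G.
Proof.
move=> hGF hFG.
have faithF := retract_faithful hGF; have faithG := retract_faithful hFG.
have [a [aI aN]] := hGF; have [b [bI bN]] := hFG.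
pose ai X := sval (cid (aI X)); pose bi Y := sval (cid (bI Y)).
have aiK X : ai X \oc a X = idm _ by rewrite /ai; case: cid => ? [].
have aKi X : a X \oc ai X = idm _ by rewrite /ai; case: cid => ? [].
have biK X : bi X \oc b X = idm _ by rewrite /bi; case: cid => ? [].
have bKi X : b X \oc bi X = idm _ by rewrite /bi; case: cid => ? [].
pose phi X Y (f : hom (F X) Y) : hom X (G Y) := fmap G f \oc ai X.
pose psi X Y (g : hom X (G Y)) : hom (F X) Y :=
  b Y \oc fmap F (g \oc a X) \oc bi (F X).
have psiK X Y : cancel (@psi X Y) (@phi X Y).
  move=> g; have E : fmap G (psi X Y g) = g \oc a X.
    apply: faithF; have /= h := bN _ _ (psi X Y g).
    rewrite -[LHS]comp_idl -(biK Y) -compA h /psi.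
    by rewrite -!compA biK comp_idr compA biK comp_idl.
  by rewrite /phi E -compA aKi comp_idr.
have phiI X Y : injective (@phi X Y).
  move=> f g E; apply: faithG.
  by rewrite -[LHS]comp_idr -[RHS]comp_idr -aiK !compA -/(phi _ _ _) E.
exists phi; split=> [X Y|X' X Y Y' h f g].
  by exists (@psi X Y) => // f; apply: (@phiI X Y); rewrite psiK.
rewrite /phi !fmap_comp -!compA; congr (_ \oc (_ \oc _)).
have /= h' := aN _ _ h.
rewrite -[LHS]comp_idl -(aiK X) -compA [a X \oc _]compA h'.
by rewrite -!compA aKi comp_idr.
Qed.

Section CompactSubcategory.
Variable T : triangulated.

Lemma compact_iso (X Y : T) : isomorphic X Y -> compact X -> compact Y.
Proof.
move=> [a [b [_ ab]]] /compactP cX; apply/compactP => I Z P inj injP f.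
have [s [g E]] := cX _ _ _ _ injP (f \oc a).
exists s, (fun i => g i \oc b).
rewrite -[LHS]comp_idr -ab compA E comp_suml.
by apply: eq_bigr => i _; rewrite compA.
Qed.

Lemma compact_zero (X : T) : is_zero X -> compact X.
Proof.
case=> X0 _; apply/compactP => I Z P inj injP f.
by rewrite (X0 _ f); apply: fin_factor0.
Qed.

Lemma compact_biproduct (X Y B : T) (i1 : hom X B) (i2 : hom Y B)
    (p1 : hom B X) (p2 : hom B Y) :
  is_biproduct i1 i2 p1 p2 -> compact X -> compact Y -> compact B.
Proof.
move=> [_ _ _ _ E] /compactP cX /compactP cY; apply/compactP.
move=> I Z P inj injP f.
have fin_comp W (h : hom W P) (k : hom B W) :
    fin_factor inj h -> fin_factor inj (h \oc k).
  move=> [s [g ->]]; exists s, (fun i => g i \oc k).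
  by rewrite comp_suml; apply: eq_bigr => i _; rewrite compA.
have -> : f = f \oc i1 \oc p1 - - (f \oc i2 \oc p2).
  by rewrite opprK -!compA -compDr E comp_idr.
apply: fin_factorB => //; first by apply: fin_comp; apply: cX injP _.
rewrite -compNl; apply: fin_comp; exact: cY injP _.
Qed.

Lemma compact_shift (X : T) : compact X <-> compact (shift X).
Proof.
have [G [hGF hFG]] := shift_equivalence T.
have FG := quasi_inverse_adjoint hGF hFG.
have GF := quasi_inverse_adjoint hFG hGF.
have addS := @shift_additive T.
split=> [cX|cX].
  apply: (adjoint_preserves_compact FG) cX; last by left.
  exact: adjoint_preserves_coproducts GF.
have [a [aI _]] := hGF; apply: (compact_iso (X := G (shift X))).
  by exists (a X); apply: aI.
apply: (adjoint_preserves_compact GF) cX; last by right.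
exact: adjoint_preserves_coproducts FG.
Qed.

Lemma dist_id_iso (X Y Z : T) (u : hom X Y) (v : hom Y Z)
    (w : hom Z (shift X)) : is_iso u -> is_zero Z -> dist u v w.
Proof.
move=> uI Z0; apply: (dist_iso (dist_id X Z0) (a := idm X) (b := u)
  (c := idm Z)) => //.
- by exists (idm X); rewrite comp_idl.
- by exists (idm Z); rewrite comp_idl.
- by rewrite (Z0.2 _ (v \oc u)) comp_idl.
- by rewrite comp0r comp_idr (Z0.1 _ w).
Qed.

Lemma dist_comp0 (X Y Z : T) (u : hom X Y) (v : hom Y Z)
    (w : hom Z (shift X)) : dist u v w -> v \oc u = 0.
Proof.
move=> d; have [O O0] := tri_zero T.
have [c [E _]] := dist_fill (a := idm X) (b := u) (dist_id X O0) d erefl.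
by rewrite -E comp0r.
Qed.

Lemma dist_weak_coker (X Y Z W : T) (u : hom X Y) (v : hom Y Z)
    (w : hom Z (shift X)) (g : hom Y W) :
  dist u v w -> g \oc u = 0 -> exists g' : hom Z W, g = g' \oc v.
Proof.
move=> d gu; have [O O0] := tri_zero T.
have d' : dist (0 : hom O W) (idm W) (0 : hom W (shift O)).
  have [G [hGF hFG]] := shift_equivalence T.
  have SO : is_zero (shift O).
    have idS : idm (shift O) = 0.
      by rewrite -fmap_id (O0.1 _ (idm O)) -{1}(addr0 (0 : hom O O)); apply:
        (addIr (fmap shift 0)); rewrite -shift_additive !addr0 add0r.
    by split=> V f; [rewrite -(comp_idr f) idS comp0r|
                     rewrite -(comp_idl f) idS comp0l].
  apply/dist_rotate; apply: dist_id_iso => //.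
  by exists (idm W); rewrite comp_idl.
have E : g \oc u = (0 : hom O W) \oc (0 : hom X O) by rewrite gu comp0l.
by have [c [cE _]] := dist_fill d d' E; exists c; rewrite cE comp_idl.
Qed.

Lemma compact_cone (X Y Z : T) (u : hom X Y) (v : hom Y Z)
    (w : hom Z (shift X)) :
  dist u v w -> compact X -> compact Y -> compact Z.
Proof.
move=> d /compact_shift /compactP cSX /compactP cY; apply/compactP.
move=> I Q P inj injP f.
have [pr [prI prI0]] := coproduct_projections injP.
have [s [us [s0 E]]] := fin_factor_supports prI prI0 (cY _ _ _ _ injP (f \oc v)).
have kP i : exists k : hom Z (Q i), pr i \oc (f \oc v) = k \oc v.
  apply: (dist_weak_coker d).
  by rewrite -!compA (dist_comp0 d) !comp0r.
pose k i := sval (cid (kP i)).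
have kE i : pr i \oc (f \oc v) = k i \oc v by rewrite /k; case: cid.
pose F := \sum_(i <- s) inj i \oc k i.
have FF : fin_factor inj F by exists s, k.
have dF : (f - F) \oc v = 0.
  rewrite compBl E comp_suml -sumrB big1 // => i _.
  by rewrite kE compA subrr.
have d1 : dist v w (- fmap shift u : hom (shift X) (shift Y)).
  by have [rot _] := dist_rotate u v w; apply: rot.
have [h hE] := dist_weak_coker d1 dF.
have -> : f = h \oc w - - F by rewrite -hE opprK subrK.
apply: fin_factorB => //.
  have [t [g ->]] := cSX _ _ _ _ injP h.
  exists t, (fun i => g i \oc w).
  by rewrite comp_suml; apply: eq_bigr => i _; rewrite compA.
rewrite -[- F]add0r; apply: fin_factorB => //; exact: fin_factor0.
Qed.

Lemma compact_triangulated_subcategory : triangulated_subcategory (@compact T).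
Proof.
split.
- exact: compact_zero.
- exact: compact_biproduct.
- exact: compact_iso.
- exact: compact_shift.
- exact: compact_cone.
Qed.

Definition compacts : triangulated :=
  full_sub_tri compact_triangulated_subcategory.

End CompactSubcategory.

Definition compactly_generated (T : triangulated) : Prop :=
  [/\ has_small_coproducts T, skeletally_small (compacts T)
    & forall Y : T, (forall X : T, compact X -> forall f : hom X Y, f = 0) ->
        is_zero Y].

Record triangle_functor (T T' : triangulated) := TriangleFunctor {
  tri_functor :> functor T T';
  tri_functor_additive : is_additive_functor tri_functor;
  tri_functor_shift :
    forall X, hom (tri_functor (shift X)) (shift (tri_functor X));
  tri_functor_shift_iso : forall X, is_iso (tri_functor_shift X);
  tri_functor_shift_natural : forall X Y (f : hom X Y),
    tri_functor_shift Y \oc fmap tri_functor (fmap shift f) =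
    fmap shift (fmap tri_functor f) \oc tri_functor_shift X;
  tri_functor_dist : forall (X Y Z : T)
    (u : hom X Y) (v : hom Y Z) (w : hom Z (shift X)), dist u v w ->
    dist (fmap tri_functor u) (fmap tri_functor v)
      (tri_functor_shift X \oc fmap tri_functor w)
}.

Section RestrictCompacts.
Variables (T T' : triangulated) (F : triangle_functor T T').
Hypothesis cF : preserves_compact F.

Definition restrict_functor : functor (compacts T) (compacts T') :=
  @Functor (compacts T) (compacts T')
    (fun X => exist _ (F (sval X)) (cF (svalP X))) (fun X Y f => fmap F f)
    (fun X => fmap_id F (sval X)) (fun _ _ _ => @fmap_comp _ _ F _ _ _).

Lemma restrict_shift_iso (X : compacts T) :
  @is_iso (compacts T') (restrict_functor (shift X))
    (shift (restrict_functor X)) (tri_functor_shift F (sval X)).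
Proof. exact: (tri_functor_shift_iso F (sval X)). Qed.

Definition restrict_compacts : triangle_functor (compacts T) (compacts T') :=
  @TriangleFunctor (compacts T) (compacts T') restrict_functor
    (fun _ _ => @tri_functor_additive _ _ F _ _)
    (fun X => tri_functor_shift F (sval X)) restrict_shift_iso
    (fun _ _ => @tri_functor_shift_natural _ _ F _ _)
    (fun _ _ _ => @tri_functor_dist _ _ F _ _ _).

End RestrictCompacts.

Record is_recollement (U T V : triangulated)
    (q : triangle_functor T U) (i : triangle_functor U T)
    (p : triangle_functor T U) (l : triangle_functor V T)
    (e : triangle_functor T V) (r : triangle_functor V T) : Prop :=
  IsRecollement {
    recollement_qi : adjoint q i;
    recollement_ip : adjoint i p;
    recollement_le : adjoint l e;
    recollement_er : adjoint e r;
    recollement_i : fully_faithful i;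
    recollement_l : fully_faithful l;
    recollement_r : fully_faithful r;
    recollement_ker : forall X : T, ess_image i X <-> is_zero (e X)
  }.

Section RecollementCompact.
Variables (U T V : triangulated).
Variables (q : triangle_functor T U) (i : triangle_functor U T).
Variables (p : triangle_functor T U) (l : triangle_functor V T).
Variables (e : triangle_functor T V) (r : triangle_functor V T).
Hypothesis R : is_recollement q i p l e r.

Lemma recollement_q_compact : preserves_compact q.
Proof.
apply: (adjoint_preserves_compact (recollement_qi R)).
  exact: (adjoint_preserves_coproducts (recollement_ip R)).
by left; apply: tri_functor_additive.
Qed.

Lemma recollement_l_compact : preserves_compact l.
Proof.
apply: (adjoint_preserves_compact (recollement_le R)).
  exact: (adjoint_preserves_coproducts (recollement_er R)).
by left; apply: tri_functor_additive.
Qed.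

End RecollementCompact.

(* Counted from the bottom, the rows of a ladder consist alternately of functors
   T -> U, V -> T (even rows) and U -> T, T -> V (odd rows).  Rows 0, 1 and 2 are
   (p, r), (i, e) and (q, l), and row j + 2 is (q^j, l^j) for j >= 1. *)
Definition ladder_row (U T V : triangulated) (b : bool) : Type :=
  if b then (triangle_functor U T * triangle_functor T V)%type
  else (triangle_functor T U * triangle_functor V T)%type.

(* Over an even bottom row, three consecutive rows have the shape (U, T, V), over
   an odd bottom row the shape (V, T, U), with the two columns exchanged. *)
Definition rows_recollement (U T V : triangulated) (b : bool) :
    ladder_row U T V (~~ ~~ b) -> ladder_row U T V (~~ b) ->
    ladder_row U T V b -> Prop :=
  match b with
  | false => fun top mid bot =>
      is_recollement top.1 mid.1 bot.1 top.2 mid.2 bot.2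
  | true => fun top mid bot =>
      is_recollement top.2 mid.2 bot.2 top.1 mid.1 bot.1
  end.

(* Only the rows of index at most m + 1 are constrained; for m >= 1 these are the
   rows up to (q^(m-1), l^(m-1)). *)
Definition has_upward_ladder (m : nat) (U T V : triangulated)
    (q : triangle_functor T U) (i : triangle_functor U T)
    (p : triangle_functor T U) (l : triangle_functor V T)
    (e : triangle_functor T V) (r : triangle_functor V T) : Prop :=
  exists R : forall j, ladder_row U T V (odd j),
    [/\ R 0 = (p, r), R 1 = (i, e), R 2 = (q, l)
      & forall j, (j < m)%N -> rows_recollement (R j.+2) (R j.+1) (R j)].

Definition alternating_functor (C D : category) (b : bool) : Type :=
  if b then functor D C else functor C D.

Definition alternating_adjoint (C D : category) (b : bool) :
    alternating_functor C D (~~ b) -> alternating_functor C D b -> Prop :=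
  match b with
  | false => fun F G => @adjoint D C F G
  | true => fun F G => @adjoint C D F G
  end.

Definition alternating_preserves_compact (C D : preadditive) (b : bool) :
    alternating_functor C D b -> Prop :=
  match b with
  | false => fun F => @preserves_compact C D F
  | true => fun F => @preserves_compact D C F
  end.

(* (s m, s (m-1)), ..., (s 2, s 1), (s 1, F) are adjoint pairs. *)
Definition left_adjoint_tower (m : nat) (C D : category) (F : functor C D)
    (s : forall j, alternating_functor C D (odd j)) : Prop :=
  s 0 = F /\ forall j, (j < m)%N -> alternating_adjoint (s j.+1) (s j).

Definition stable_t_structure (T : triangulated) (X Y : T -> Prop) : Prop :=
  [/\ triangulated_subcategory X, triangulated_subcategory Y,
      forall A B, X A -> Y B -> forall f : hom A B, f = 0
    & forall C : T, exists (A B : T) (u : hom A C) (v : hom C B)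
        (w : hom B (shift A)), [/\ X A, Y B & dist u v w]].

Definition TTF_triple (T : triangulated) (X Y Z : T -> Prop) : Prop :=
  stable_t_structure X Y /\ stable_t_structure Y Z.

Definition compact_part (T : triangulated) (X : T -> Prop) :
  compacts T -> Prop := fun C => X (sval C).

(* Main.v *)
From Pilot Require Import Defs.
From HB Require Import structures.
From mathcomp Require Import all_boot ssralg ring_quotient.
From mathcomp Require Import boolp zify.
(* Imported again so that [compA] is the associativity of composition in a
   category. *)
Import Pilot.Defs.

Set Implicit Arguments.
Unset Strict Implicit.
Unset Printing Implicit Defensive.

(** The rows of a ladder are best examined two at a time.  Consecutive rows,
    say [(q, l)] above [(i, e)], satisfy: [q] is left adjoint to [i], [l] is
    left adjoint to [e], the functors [i] and [l] are fully faithful, and the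
    image of [i] is the kernel of [e].  Such a half of a recollement amounts to
    a stable t-structure formed by the images of [l] and [i]; in particular the
    image of [l] is the kernel of [q].  A recollement consists of two halves
    sharing their middle row ([recollement_halves]), so a ladder of height [n]
    is a tower of [n - 1] further rows above [(q, l)] in which consecutive rows
    form halves ([upward_ladderP]).

    One more row exists as soon as one of [q] and [l] has a left adjoint.  If
    [l1] is left adjoint to [l], then [q] identifies the left orthogonal of the
    image of [l] with [U], and the inverse of this identification is left
    adjoint to [q] ([half_up_l]).  If [q1] is left adjoint to [q], then [q1] is
    fully faithful, and the cones of the counits [q1 (q Z) -> Z] lie in the
    kernel of [q], which is the image of [l]; they are the reflections of the
    objects [Z] that a left adjoint of [l] requires ([half_up_q]).  Climbing row
    by row ([row_tower_build]) one obtains the ladder from either sequence of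
    adjoints.  A stable t-structure whose right class is the image of the fully
    faithful functor [l] also yields a left adjoint of [l], by truncation, which
    accounts for the TTF-triples in [T].

    The functors [q], [l] and all those above them are left adjoints of functors
    that preserve coproducts; hence they preserve coproducts and compact
    objects, and the halves restrict to the compact objects.  The way back is
    [left_adjoint_of_compacts]: if a triangle functor [F : D -> C] between
    compactly generated categories preserves coproducts and compact objects, and
    its restriction to compact objects has a left adjoint [L], then [F] has a
    left adjoint.  No representability theorem enters.  For [X] compact, the map
    [hom (L X) Y -> hom X (F Y)] is bijective for [Y] compact; both sides are
    homological in [Y] and commute with coproducts, so it is bijective for all
    [Y].  Next, the objects [X] for which [hom X (F -)] is corepresentable are
    closed under cones ([universal_cone]) and coproducts.  Both steps conclude
    by [compactly_generated_ind]: a class of objects closed under cones,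
    coproducts and isomorphisms that contains the compact objects contains
    everything, because every object is a homotopy colimit of objects built
    from compact ones. *)

Import GRing.Theory.
Local Open Scope category_scope.
Local Open Scope ring_scope.

(** * Universal arrows and adjunctions *)

Section Categories.

Lemma is_iso_id (C : category) (X : C) : is_iso (idm X).
Proof. by exists (idm X); rewrite comp_idl. Qed.

Lemma is_iso_comp (C : category) (X Y Z : C) (g : hom Y Z) (f : hom X Y) :
  is_iso g -> is_iso f -> is_iso (g \oc f).
Proof.
move=> [g' [g'g gg']] [f' [f'f ff']]; exists (f' \oc g'); split.
  by rewrite -compA (compA g') g'g comp_idl.
by rewrite -compA (compA f) ff' comp_idl.
Qed.

Lemma is_iso_fmap (C D : category) (F : functor C D) (X Y : C) (f : hom X Y) :
  is_iso f -> is_iso (fmap F f).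
Proof.
by move=> [g [gf fg]]; exists (fmap F g); rewrite -!fmap_comp gf fg !fmap_id.
Qed.

Lemma isomorphic_refl (C : category) (X : C) : isomorphic X X.
Proof. by exists (idm X); apply: is_iso_id. Qed.

Lemma isomorphic_sym (C : category) (X Y : C) :
  isomorphic X Y -> isomorphic Y X.
Proof. by move=> [f [g [gf fg]]]; exists g, f. Qed.

Lemma isomorphic_trans (C : category) (X Y Z : C) :
  isomorphic X Y -> isomorphic Y Z -> isomorphic X Z.
Proof. by move=> [f fI] [g gI]; exists (g \oc f); apply: is_iso_comp. Qed.

Lemma isomorphic_fmap (C D : category) (F : functor C D) (X Y : C) :
  isomorphic X Y -> isomorphic (F X) (F Y).
Proof. by move=> [f fI]; exists (fmap F f); apply: is_iso_fmap. Qed.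

Lemma iso_epi (C : category) (X Y Z : C) (f : hom X Y) (g g' : hom Y Z) :
  is_iso f -> g \oc f = g' \oc f -> g = g'.
Proof.
by move=> [k [_ fk]] E; rewrite -[g]comp_idr -[g']comp_idr -fk !compA E.
Qed.

Lemma iso_mono (C : category) (X Y Z : C) (f : hom Y Z) (g g' : hom X Y) :
  is_iso f -> f \oc g = f \oc g' -> g = g'.
Proof.
by move=> [k [kf _]] E; rewrite -[g]comp_idl -[g']comp_idl -kf -!compA E.
Qed.

(** Universality of [eta] is split into its parts at the single objects [Y]
    because it is known for compact [Y] first. *)
Definition represents (C D : category) (G : functor D C) (X : C) (L : D)
    (eta : hom X (G L)) (Y : D) : Prop :=
  (forall g : hom X (G Y), exists f : hom L Y, fmap G f \oc eta = g) /\
  (forall f f' : hom L Y, fmap G f \oc eta = fmap G f' \oc eta -> f = f').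

Definition universal_arrow (C D : category) (G : functor D C) (X : C) (L : D)
    (eta : hom X (G L)) : Prop := forall Y, represents eta Y.

Definition unit_natural (C D : category) (F : functor C D) (G : functor D C)
    (eta : forall X, hom X (G (F X))) : Prop :=
  forall X Y (f : hom X Y), eta Y \oc f = fmap G (fmap F f) \oc eta X.

Definition counit_natural (C D : category) (F : functor C D) (G : functor D C)
    (eps : forall Y, hom (F (G Y)) Y) : Prop :=
  forall X Y (f : hom X Y), eps Y \oc fmap F (fmap G f) = f \oc eps X.

Lemma adjoint_unit_counit (C D : category) (F : functor C D)
    (G : functor D C) : adjoint F G ->
  exists (eta : forall X, hom X (G (F X))) (eps : forall Y, hom (F (G Y)) Y),
    [/\ unit_natural eta, counit_natural eps,
        forall X, eps (F X) \oc fmap F (eta X) = idm (F X)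
      & forall Y, fmap G (eps Y) \oc eta (G Y) = idm (G Y)].
Proof.
move=> [phi [phiB phiN]].
have phiNr X Y1 Y2 (g : hom Y1 Y2) (h : hom (F X) Y1) :
    phi _ _ (g \oc h) = fmap G g \oc phi _ _ h.
  have := phiN _ _ _ _ (idm X) h g.
  by rewrite fmap_id !comp_idr.
have phiNl X1 X2 Z (g : hom X1 X2) (h : hom (F X2) Z) :
    phi _ _ (h \oc fmap F g) = phi _ _ h \oc g.
  have := phiN _ _ _ _ g h (idm Z).
  by rewrite comp_idl fmap_id comp_idl.
have epsP Y : exists f : hom (F (G Y)) Y, phi _ _ f = idm (G Y).
  by have [psi _ psiK] := phiB (G Y) Y; exists (psi (idm _)).
pose eps Y := sval (cid (epsP Y)).
have epsE Y : phi _ _ (eps Y) = idm (G Y) by rewrite /eps; case: cid.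
exists (fun X => phi _ _ (idm (F X))), eps; split.
- by move=> X Y f; rewrite -phiNl -phiNr comp_idl comp_idr.
- move=> X Y f; apply: (bij_inj (phiB _ _)).
  by rewrite phiNl phiNr !epsE comp_idl comp_idr.
- by move=> X; apply: (bij_inj (phiB _ _)); rewrite phiNl epsE comp_idl.
- by move=> Y; rewrite -phiNr comp_idr epsE.
Qed.

Lemma unit_universal (C D : category) (F : functor C D) (G : functor D C)
    (eta : forall X, hom X (G (F X))) (eps : forall Y, hom (F (G Y)) Y) :
  unit_natural eta -> counit_natural eps ->
  (forall X, eps (F X) \oc fmap F (eta X) = idm (F X)) ->
  (forall Y, fmap G (eps Y) \oc eta (G Y) = idm (G Y)) ->
  forall X, universal_arrow (eta X).
Proof.
move=> etaN epsN Feta Geps X Y; split=> [g|f f' E].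
  exists (eps Y \oc fmap F g).
  by rewrite fmap_comp -compA -etaN compA Geps comp_idl.
have H (h : hom (F X) Y) : h = eps Y \oc fmap F (fmap G h \oc eta X).
  by rewrite fmap_comp compA epsN -compA Feta comp_idr.
by rewrite (H f) (H f') E.
Qed.

Lemma adjoint_universal (C D : category) (F : functor C D)
    (G : functor D C) : adjoint F G ->
  exists eta : forall X, hom X (G (F X)),
    unit_natural eta /\ forall X, universal_arrow (eta X).
Proof.
move=> /adjoint_unit_counit[eta [eps [etaN epsN Feta Geps]]].
by exists eta; split=> //; apply: unit_universal Geps.
Qed.

Lemma universal_adjoint_functor (C D : category) (F : functor C D)
    (G : functor D C) (eta : forall X, hom X (G (F X))) :
  unit_natural eta -> (forall X, universal_arrow (eta X)) -> adjoint F G.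
Proof.
move=> etaN etaU; exists (fun X Y f => fmap G f \oc eta X); split=> [X Y|].
  have [surj inj] := etaU X Y.
  pose psi g := sval (cid (surj g)).
  have psiE g : fmap G (psi g) \oc eta X = g by rewrite /psi; case: cid.
  by exists psi => // f; apply: inj; rewrite psiE.
move=> X' X Y Y' h f g.
by rewrite !fmap_comp -!compA etaN.
Qed.

Lemma universal_adjoint (C D : category) (G : functor D C) :
  (forall X, exists L (eta : hom X (G L)), universal_arrow eta) ->
  exists F, adjoint F G.
Proof.
move=> H.
pose L X := sval (cid (H X)).
have H1 X : exists eta : hom X (G (L X)), universal_arrow eta.
  by rewrite /L; case: cid.
pose eta X := sval (cid (H1 X)).
have etaU X : universal_arrow (eta X) by rewrite /eta; case: cid.
have HF X Y (f : hom X Y) : exists g : hom (L X) (L Y),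
    fmap G g \oc eta X = eta Y \oc f by apply: (etaU X (L Y)).1.
pose Fm X Y (f : hom X Y) := sval (cid (HF X Y f)).
have FE X Y (f : hom X Y) : fmap G (Fm X Y f) \oc eta X = eta Y \oc f.
  by rewrite /Fm; case: cid.
have F1 X : Fm X X (idm X) = idm (L X).
  by apply: (etaU _ _).2; rewrite FE fmap_id comp_idl comp_idr.
have FM X Y Z (g : hom Y Z) (f : hom X Y) :
    Fm X Z (g \oc f) = Fm Y Z g \oc Fm X Y f.
  by apply: (etaU _ _).2; rewrite fmap_comp -compA !FE !compA FE.
exists (Functor F1 FM).
exact: (@universal_adjoint_functor _ _ (Functor F1 FM) G eta).
Qed.

Lemma universal_arrow_unique (C D : category) (G : functor D C) (X : C)
    (L L' : D) (eta : hom X (G L)) (eta' : hom X (G L')) :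
  universal_arrow eta -> universal_arrow eta' ->
  exists theta : hom L L', is_iso theta /\ fmap G theta \oc eta = eta'.
Proof.
move=> U U'; have [t tE] := (U L').1 eta'; have [t' tE'] := (U' L).1 eta.
exists t; split=> //; exists t'; split.
  by apply: (U L).2; rewrite fmap_comp -compA tE tE' fmap_id comp_idl.
by apply: (U' L').2; rewrite fmap_comp -compA tE' tE fmap_id comp_idl.
Qed.

(** Left adjoints are unique up to a natural isomorphism, which can be composed
    with the unit of an adjunction one level higher. *)
Lemma adjoint_transfer (C D : category) (F F' : functor C D)
    (G : functor D C) (L : functor D C) :
  adjoint F G -> adjoint F' G -> adjoint L F -> adjoint L F'.
Proof.
move=> /adjoint_universal[eta [etaN etaU]].
move=> /adjoint_universal[eta' [etaN' etaU']].
move=> /adjoint_universal[mu [muN muU]].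
have H X := universal_arrow_unique (etaU X) (etaU' X).
pose a X := sval (cid (H X)).
have aI X : is_iso (a X) by rewrite /a; case: cid => ? [].
have aE X : fmap G (a X) \oc eta X = eta' X by rewrite /a; case: cid => ? [].
have aN X Y (f : hom X Y) : a Y \oc fmap F f = fmap F' f \oc a X.
  apply: (etaU _ _).2.
  by rewrite !fmap_comp -!compA -etaN aE compA aE etaN'.
apply: (universal_adjoint_functor (eta := fun X => a (L X) \oc mu X)).
  by move=> X Y f; rewrite -compA muN !compA aN.
move=> X Y; split=> [g|f f']; last first.
  by rewrite !compA -!aN -!compA => /(iso_mono (aI _)); apply: (muU X Y).2.
have [b [ba ab]] := aI Y; have [f fE] := (muU X Y).1 (b \oc g).
by exists f; rewrite compA -aN -compA fE compA ab comp_idl.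
Qed.

Lemma adjoint_counit_iso (C D : category) (F : functor C D) (G : functor D C)
    (eta : forall X, hom X (G (F X))) (eps : forall Y, hom (F (G Y)) Y) :
  counit_natural eps ->
  (forall X, eps (F X) \oc fmap F (eta X) = idm (F X)) ->
  (forall Y, fmap G (eps Y) \oc eta (G Y) = idm (G Y)) ->
  fully_faithful G -> forall Y, is_iso (eps Y).
Proof.
move=> epsN Feta Geps Gff Y.
have [Gi GiK GKi] := Gff Y (F (G Y)).
exists (Gi (eta (G Y))); split; last first.
  by apply: (bij_inj (Gff _ _)); rewrite fmap_comp GKi Geps fmap_id.
by rewrite -epsN GKi Feta.
Qed.

Lemma adjoint_unit_iso (C D : category) (F : functor C D) (G : functor D C)
    (eta : forall X, hom X (G (F X))) (eps : forall Y, hom (F (G Y)) Y) :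
  unit_natural eta ->
  (forall X, eps (F X) \oc fmap F (eta X) = idm (F X)) ->
  (forall Y, fmap G (eps Y) \oc eta (G Y) = idm (G Y)) ->
  fully_faithful F -> forall X, is_iso (eta X).
Proof.
move=> etaN Feta Geps Fff X.
have [Fi FiK FKi] := Fff (G (F X)) X.
exists (Fi (eps (F X))); split.
  by apply: (bij_inj (Fff _ _)); rewrite fmap_comp FKi Feta fmap_id.
by rewrite etaN FKi Geps.
Qed.

(** Since [hom (F1 X) (F1 Y) = hom X (F0 (F1 Y))], it is enough to invert the
    unit [X -> F0 (F1 X)].  Composition with it is the bijection
    [hom (F0 (F1 X)) Y = hom (F1 X) (G Y) = hom X (F0 (G Y)) = hom X Y], whose
    last step is the invertible counit of [(F0, G)]. *)
Lemma adjoint_triple_fully_faithful (C D : category) (F1 : functor C D)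
    (F0 : functor D C) (G : functor C D) :
  adjoint F1 F0 -> adjoint F0 G -> fully_faithful G -> fully_faithful F1.
Proof.
move=> /adjoint_universal[eta [etaN etaU]].
move=> /adjoint_unit_counit[mu [eps [muN epsN Fmu Geps]]] Gff.
have epsI := adjoint_counit_iso epsN Fmu Geps Gff.
have muU := unit_universal muN epsN Fmu Geps.
(* A map out of [F0 (F1 X)] is recovered from its composite with the unit. *)
have key X Y (h : hom (F0 (F1 X)) Y) :
    eps Y \oc (fmap F0 (fmap G h \oc mu (F1 X)) \oc eta X) = h \oc eta X.
  by rewrite fmap_comp !compA epsN -[h \oc _ \oc _]compA Fmu comp_idr.
have etaI X : is_iso (eta X).
  have [e [ee1 ee2]] := epsI X.
  have [f fE] := (etaU X _).1 e; have [h hE] := (muU _ _).1 f.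
  have hK : h \oc eta X = idm X by rewrite -key hE fE.
  exists h; split=> //.
  have inj (Y : C) (k k' : hom (F0 (F1 X)) Y) :
      k \oc eta X = k' \oc eta X -> k = k'.
    rewrite -(key _ _ k) -(key _ _ k') => /(iso_mono (epsI _)) /(etaU _ _).2 E.
    exact: (muU _ _).2 E.
  by apply: inj; rewrite -compA hK comp_idl comp_idr.
move=> X Y; have [t [t1 t2]] := etaI Y.
have sf (g : hom (F1 X) (F1 Y)) : fmap F1 (t \oc (fmap F0 g \oc eta X)) = g.
  by apply: (etaU _ _).2; rewrite -etaN !compA t2 comp_idl.
exists (fun g => t \oc (fmap F0 g \oc eta X)) => // f.
by rewrite -etaN compA t1 comp_idl.
Qed.

End Categories.

(** * Triangles, and adjoints of triangle functors *)

Section Additive.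

Lemma is_zeroP (C : preadditive) (X : C) : is_zero X <-> idm X = 0.
Proof.
split=> [[X0 _]|E]; first exact: X0.
split=> Y f; first by rewrite -(comp_idr f) E comp0r.
by rewrite -(comp_idl f) E comp0l.
Qed.

Lemma is_zero_iso (C : preadditive) (X Y : C) :
  isomorphic X Y -> is_zero X -> is_zero Y.
Proof.
move=> [f [g [_ fg]]] [X0 _]; apply/is_zeroP.
by rewrite -fg (X0 _ f) comp0l.
Qed.

Variables (C D : preadditive) (F : functor C D).
Hypothesis addF : is_additive_functor F.

Lemma additive_fmap0 (X Y : C) : fmap F (0 : hom X Y) = 0.
Proof. by apply: (addIr (fmap F 0)); rewrite -addF !add0r. Qed.

Lemma additive_fmapN (X Y : C) (f : hom X Y) : fmap F (- f) = - fmap F f.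
Proof. by apply: (addIr (fmap F f)); rewrite -addF !addNr additive_fmap0. Qed.

Lemma additive_fmapB (X Y : C) (f g : hom X Y) :
  fmap F (f - g) = fmap F f - fmap F g.
Proof. by rewrite addF additive_fmapN. Qed.

Lemma additive_fmap_sum (X Y : C) (I : Type) (s : seq I) (f : I -> hom X Y) :
  fmap F (\sum_(i <- s) f i) = \sum_(i <- s) fmap F (f i).
Proof. exact: (big_morph _ (@addF X Y) (additive_fmap0 X Y)). Qed.

Lemma additive_zero (X : C) : is_zero X -> is_zero (F X).
Proof.
by move=> /is_zeroP E; apply/is_zeroP; rewrite -fmap_id E additive_fmap0.
Qed.

Lemma represents_inj (X : D) (L : C) (eta : hom X (F L)) (Y : C) :
  (forall f : hom L Y, fmap F f \oc eta = 0 -> f = 0) ->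
  forall f f' : hom L Y, fmap F f \oc eta = fmap F f' \oc eta -> f = f'.
Proof.
move=> H f f' E; apply/eqP; rewrite -subr_eq0; apply/eqP/H.
by rewrite additive_fmapB compBl E subrr.
Qed.

Lemma represents0 (X : D) (L : C) (eta : hom X (F L)) (Y : C) :
  represents eta Y -> forall f : hom L Y, fmap F f \oc eta = 0 -> f = 0.
Proof. by move=> [_ I] f E; apply: I; rewrite E additive_fmap0 comp0l. Qed.

End Additive.

Lemma left_adjoint_additive (C D : preadditive) (F : functor C D)
    (G : functor D C) :
  adjoint F G -> is_additive_functor G -> is_additive_functor F.
Proof.
move=> /adjoint_universal[eta [etaN etaU]] addG X Y f g.
by apply: (etaU X _).2; rewrite addG compDl -!etaN compDr.
Qed.

Section Triangles.
Variable T : triangulated.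

Lemma shift_surjective (Y : T) : exists X : T, isomorphic (shift X) Y.
Proof.
have [G [_ [b [bI _]]]] := shift_equivalence T.
by exists (G Y), (b Y); apply: bI.
Qed.

Lemma shift_faithful (X Y : T) (f g : hom X Y) :
  fmap shift f = fmap shift g -> f = g.
Proof.
have [G [hGF _]] := shift_equivalence T.
exact: (retract_faithful hGF).
Qed.

Lemma shift_full (X Y : T) (g : hom (shift X) (shift Y)) :
  exists f : hom X Y, fmap shift f = g.
Proof.
have [G [[a [aI aN]] hFG]] := shift_equivalence T.
have [b [ba ab]] := aI X.
exists (a Y \oc fmap G g \oc b); apply: (retract_faithful hFG).
apply: (iso_mono (aI Y)); have /= -> := aN _ _ (a Y \oc fmap G g \oc b).
by rewrite -compA ba comp_idr.
Qed.

Lemma shift0 (X Y : T) : fmap shift (0 : hom X Y) = 0.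
Proof. exact: additive_fmap0 (@shift_additive T) _ _. Qed.

Lemma is_zero_shift (X : T) : is_zero (shift X) <-> is_zero X.
Proof.
split=> [/is_zeroP E|]; last exact: additive_zero (@shift_additive T) X.
by apply/is_zeroP/shift_faithful; rewrite shift0 fmap_id.
Qed.

Section OneTriangle.
Variables (X Y Z : T) (u : hom X Y) (v : hom Y Z) (w : hom Z (shift X)).
Hypothesis d : dist u v w.

Lemma dist_rot : dist v w (- fmap shift u : hom (shift X) (shift Y)).
Proof. by have [rot _] := dist_rotate u v w; apply: rot. Qed.

Lemma dist_comp0_second : w \oc v = 0.
Proof. exact: dist_comp0 dist_rot. Qed.

Lemma dist_weak_coker_second W (g : hom Z W) :
  g \oc v = 0 -> exists g' : hom (shift X) W, g = g' \oc w.
Proof. exact: dist_weak_coker dist_rot. Qed.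

End OneTriangle.

(** The last map of a rotated triangle is [- fmap shift u]; this lemma and
    [dist_weak_coker_third] below absorb the sign. *)
Lemma dist_comp0_third (X Y Z : T) (u : hom X Y) (v : hom Y Z)
    (w : hom Z (shift X)) : dist u v w -> fmap shift u \oc w = 0.
Proof.
move=> d; have /eqP := dist_comp0_second (dist_rot d).
by rewrite compNl oppr_eq0 => /eqP.
Qed.

Lemma dist_weak_coker_third (X Y Z W : T) (u : hom X Y) (v : hom Y Z)
    (w : hom Z (shift X)) (g : hom (shift X) W) :
  dist u v w -> g \oc w = 0 ->
  exists g' : hom (shift Y) W, g = g' \oc fmap shift u.
Proof.
move=> d gw; have [g' E] := dist_weak_coker_second (dist_rot d) gw.
by exists (- g'); rewrite E compNl compNr.
Qed.

(** Compare the given triangle with the rotation of [W = W -> 0 -> shift W]. *)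
Lemma dist_weak_ker (X Y Z W : T) (u : hom X Y) (v : hom Y Z)
    (w : hom Z (shift X)) (f : hom W Y) :
  dist u v w -> v \oc f = 0 -> exists f' : hom W X, f = u \oc f'.
Proof.
move=> d vf; have [O O0] := tri_zero T.
have E : (0 : hom O Z) \oc (0 : hom W O) = v \oc f by rewrite comp0l vf.
have [c [_ cE]] := dist_fill (dist_rot (dist_id W O0)) (dist_rot d) E.
have [f' f'E] := shift_full c; exists f'; apply: shift_faithful.
move: cE; rewrite fmap_id compNr compNl comp_idr => /eqP.
by rewrite eqr_opp fmap_comp f'E => /eqP.
Qed.

Lemma dist_weak_ker_second (X Y Z W : T) (u : hom X Y) (v : hom Y Z)
    (w : hom Z (shift X)) (f : hom W Z) :
  dist u v w -> w \oc f = 0 -> exists f' : hom W Y, f = v \oc f'.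
Proof. by move=> d; apply: dist_weak_ker (dist_rot d). Qed.

Lemma dist_weak_ker_third (X Y Z W : T) (u : hom X Y) (v : hom Y Z)
    (w : hom Z (shift X)) (f : hom W (shift X)) :
  dist u v w -> fmap shift u \oc f = 0 -> exists f' : hom W Z, f = w \oc f'.
Proof.
move=> d uf; apply: (dist_weak_ker_second (dist_rot d)).
by rewrite compNl uf oppr0.
Qed.

Lemma dist_cocone (Y Z : T) (v : hom Y Z) :
  exists X (u : hom X Y) (w : hom Z (shift X)), dist u v w.
Proof.
have [C [b [c d]]] := dist_cone v.
have [X [t tI]] := shift_surjective C; have [t' [t't tt']] := tI.
have [u uE] := shift_full (- (c \oc t)).
exists X, u, (t' \oc b); have [_ unrotate] := dist_rotate u v (t' \oc b).
apply: unrotate.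
apply: (dist_iso d (a := idm Y) (b := idm Z) (c := t')).
- exact: is_iso_id.
- exact: is_iso_id.
- by exists t.
- by rewrite comp_idl comp_idr.
- by rewrite comp_idr.
- by rewrite fmap_id comp_idl uE opprK -compA tt' comp_idr.
Qed.

Lemma dist_zero_cone (X Y Z : T) (u : hom X Y) (v : hom Y Z)
    (w : hom Z (shift X)) : dist u v w -> is_iso u <-> is_zero Z.
Proof.
move=> d; split=> [uI|[Z1 Z2]].
  apply/is_zeroP.
  have v0 : v = 0 by apply: (iso_epi uI); rewrite comp0l (dist_comp0 d).
  have w0 : w = 0.
    apply: (iso_mono (is_iso_fmap shift uI)).
    by rewrite comp0r (dist_comp0_third d).
  have [g ->] : exists g, idm Z = g \oc w.
    by apply: (dist_weak_coker_second d); rewrite v0 comp0r.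
  by rewrite w0 comp0r.
have [s sE] : exists s, idm Y = u \oc s.
  by apply: (dist_weak_ker d); rewrite comp_idr (Z2 _ v).
exists s; split=> //; apply/eqP; rewrite -subr_eq0; apply/eqP.
apply: shift_faithful; rewrite shift0.
have [f' ->] : exists f', fmap shift (s \oc u - idm X) = w \oc f'.
  apply: (dist_weak_ker_third d).
  by rewrite -fmap_comp compBr compA -sE comp_idl comp_idr subrr shift0.
by rewrite (Z1 _ w) comp0l.
Qed.

Lemma dist_zero_cocone (X Y Z : T) (u : hom X Y) (v : hom Y Z)
    (w : hom Z (shift X)) : dist u v w -> is_iso v <-> is_zero X.
Proof.
move=> d; split=> [/(dist_zero_cone (dist_rot d))/is_zero_shift //|].
by move=> /is_zero_shift /(dist_zero_cone (dist_rot d)).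
Qed.

End Triangles.

Section TriangleFunctors.
Variables (C D : triangulated).

Lemma tri_fmap0 (F : triangle_functor C D) (X Y : C) :
  fmap F (0 : hom X Y) = 0.
Proof. exact: additive_fmap0 (@tri_functor_additive _ _ F) _ _. Qed.

Lemma tri_zero_image (F : triangle_functor C D) (X : C) :
  is_zero X -> is_zero (F X).
Proof. exact: additive_zero (@tri_functor_additive _ _ F) _. Qed.

Lemma tri_shift_isomorphic (F : triangle_functor C D) (X : C) :
  isomorphic (F (shift X)) (shift (F X)).
Proof. by exists (tri_functor_shift F X); apply: tri_functor_shift_iso. Qed.

Lemma kernel_triangulated (F : triangle_functor C D) :
  triangulated_subcategory (fun X => is_zero (F X)).
Proof.
split.
- by move=> X; apply: tri_zero_image.
- move=> X Y B i1 i2 p1 p2 [_ _ _ _ E] [_ X0] [_ Y0]; apply/is_zeroP.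
  rewrite -fmap_id -E tri_functor_additive !fmap_comp.
  by rewrite (X0 _ (fmap F p1)) (Y0 _ (fmap F p2)) !comp0r addr0.
- by move=> X Y XY; apply: is_zero_iso; apply: isomorphic_fmap.
- move=> X; split=> [X0|X0].
    apply: is_zero_iso (isomorphic_sym (tri_shift_isomorphic F X)) _.
    exact/is_zero_shift.
  exact/is_zero_shift/(is_zero_iso (tri_shift_isomorphic F X)).
- move=> X Y Z u v w /(tri_functor_dist F) d X0 [Y0 _]; apply/is_zeroP.
  have [g ->] : exists g,
      idm (F Z) = g \oc (tri_functor_shift F X \oc fmap F w).
    by apply: (dist_weak_coker_second d); rewrite comp_idl; apply: Y0.
  move/is_zero_shift: X0 => [X0 _].
  by rewrite (X0 _ g) comp0l.
Qed.

End TriangleFunctors.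

Section UniversalTriangles.
Variables (C D : triangulated) (G : triangle_functor D C).

Definition unshift (Y : D) : hom (shift (G Y)) (G (shift Y)) :=
  sval (cid (tri_functor_shift_iso G Y)).

Lemma unshiftK (Y : D) : unshift Y \oc tri_functor_shift G Y = idm _.
Proof. by rewrite /unshift; case: cid => ? []. Qed.

Lemma shift_unshift (Y : D) : tri_functor_shift G Y \oc unshift Y = idm _.
Proof. by rewrite /unshift; case: cid => ? []. Qed.

Lemma unshift_iso (Y : D) : is_iso (unshift Y).
Proof.
by exists (tri_functor_shift G Y); rewrite unshiftK shift_unshift.
Qed.

Lemma unshift_natural (Y Y' : D) (f : hom Y Y') :
  fmap G (fmap shift f) \oc unshift Y = unshift Y' \oc fmap shift (fmap G f).
Proof.
apply: (iso_mono (tri_functor_shift_iso G Y')).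
rewrite !compA tri_functor_shift_natural shift_unshift comp_idl.
by rewrite -compA shift_unshift comp_idr.
Qed.

(** The suspension of an arrow into [G], read as an arrow into [G] again. *)
Definition shift_arrow (X : C) (L : D) (eta : hom X (G L)) :
  hom (shift X) (G (shift L)) := unshift L \oc fmap shift eta.

Lemma shift_arrowE (X : C) (L Y : D) (eta : hom X (G L)) (f : hom L Y) :
  fmap G (fmap shift f) \oc shift_arrow eta =
  unshift Y \oc fmap shift (fmap G f \oc eta).
Proof. by rewrite /shift_arrow compA unshift_natural fmap_comp compA. Qed.

Lemma represents_shift (X : C) (L Y : D) (eta : hom X (G L)) :
  represents eta Y <-> represents (shift_arrow eta) (shift Y).
Proof.
split=> -[surj inj]; split=> [g|f f'].
- have [g' g'E] := shift_full (tri_functor_shift G Y \oc g).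
  have [f fE] := surj g'; exists (fmap shift f).
  by rewrite shift_arrowE fE g'E compA unshiftK comp_idl.
- have [k <-] := shift_full f; have [k' <-] := shift_full f'.
  rewrite !shift_arrowE => /(iso_mono (unshift_iso _)) /shift_faithful /inj.
  by move=> ->.
- have [f fE] := surj (unshift Y \oc fmap shift g).
  have [k kE] := shift_full f; exists k; apply: shift_faithful.
  by apply: (iso_mono (unshift_iso _)); rewrite -shift_arrowE kE.
- move=> E; apply: shift_faithful; apply: inj.
  by rewrite !shift_arrowE E.
Qed.

Lemma represents_target_iso (X : C) (L Y Y' : D) (eta : hom X (G L)) :
  isomorphic Y Y' -> represents eta Y -> represents eta Y'.
Proof.
move=> [t [s [st ts]]] [surj inj]; split=> [g|f f' E].
  have [f fE] := surj (fmap G s \oc g); exists (t \oc f).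
  by rewrite fmap_comp -compA fE compA -fmap_comp ts fmap_id comp_idl.
have sI : is_iso s by exists t.
by apply: (iso_mono sI); apply: inj; rewrite !fmap_comp -!compA E.
Qed.

(** Universality at [Y] only depends on the arrow [eta] up to isomorphism. *)
Lemma represents_source_iso (X X' : C) (L L' Y : D) (eta : hom X (G L))
    (eta' : hom X' (G L')) (a : hom X X') (b : hom L L') :
  is_iso a -> is_iso b -> eta' \oc a = fmap G b \oc eta ->
  represents eta Y <-> represents eta' Y.
Proof.
move=> aI bI E; have [a' [a'a aa']] := aI; have [b' [b'b bb']] := bI.
have E' : eta \oc a' = fmap G b' \oc eta'.
  apply: (iso_epi aI); rewrite -!compA a'a E comp_idr compA -fmap_comp b'b.
  by rewrite fmap_id comp_idl.
split=> -[surj inj]; split=> [g|f f' Ef].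
- have [f fE] := surj (g \oc a); exists (f \oc b').
  rewrite fmap_comp -compA -E' compA fE -compA aa' comp_idr //.
- apply: (iso_epi bI); apply: inj.
  by rewrite !fmap_comp -!compA -E !compA Ef.
- have [f fE] := surj (g \oc a'); exists (f \oc b).
  by rewrite fmap_comp -compA -E compA fE -compA a'a comp_idr.
- have b'I : is_iso b' by exists b.
  apply: (iso_epi b'I); apply: inj.
  by rewrite !fmap_comp -!compA -E' !compA Ef.
Qed.

Lemma universal_shift (X : C) (L : D) (eta : hom X (G L)) :
  universal_arrow eta -> universal_arrow (shift_arrow eta).
Proof.
move=> U Y; have [Y' Y'Y] := shift_surjective Y.
apply: (represents_target_iso Y'Y).
by have [H _] := represents_shift Y' eta; apply: H.
Qed.

(** The five lemma for the natural transformation from [hom C -] to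
    [hom Z (G -)] induced by [h]. *)
Lemma universal_cone (X Y Z : C) (LX LY LZ : D) (u : hom X Y) (v : hom Y Z)
    (w : hom Z (shift X)) (a : hom LX LY) (c : hom LY LZ)
    (c' : hom LZ (shift LX)) (etaX : hom X (G LX)) (etaY : hom Y (G LY))
    (h : hom Z (G LZ)) :
  dist u v w -> dist a c c' -> universal_arrow etaX -> universal_arrow etaY ->
  fmap G a \oc etaX = etaY \oc u -> h \oc v = fmap G c \oc etaY ->
  fmap G c' \oc h = shift_arrow etaX \oc w -> universal_arrow h.
Proof.
move=> d dL UX UY Ea Ec Ec' W.
have addG := @tri_functor_additive _ _ G.
have [SX SY] := (universal_shift UX, universal_shift UY).
split=> [g|]; last apply: represents_inj => // t t0.
  have [y yE] := (UY W).1 (g \oc v).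
  have [t tE] : exists t : hom LZ W, y = t \oc c.
    apply: (dist_weak_coker dL); apply: (represents0 addG (UX W)).
    by rewrite fmap_comp -compA Ea compA yE -compA (dist_comp0 d) comp0r.
  have [m mE] : exists m : hom (shift X) (G W), g - fmap G t \oc h = m \oc w.
    apply: (dist_weak_coker_second d).
    by rewrite compBl -compA Ec compA -fmap_comp -tE yE subrr.
  have [m' m'E] := (SX W).1 m.
  exists (t + m' \oc c'); rewrite addG compDl fmap_comp -compA Ec' compA m'E.
  by rewrite -mE addrC subrK.
have [m' tE] : exists m' : hom (shift LX) W, t = m' \oc c'.
  apply: (dist_weak_coker_second dL); apply: (represents0 addG (UY W)).
  by rewrite fmap_comp -compA -Ec compA t0 comp0l.
have [n nE] : exists n : hom (shift Y) (G W),
    fmap G m' \oc shift_arrow etaX = n \oc fmap shift u.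
  apply: (dist_weak_coker_third d).
  by rewrite -compA -Ec' compA -fmap_comp -tE.
have [n' n'E] := (SY W).1 n.
have -> : t = n' \oc (fmap shift a \oc c').
  rewrite tE compA; congr (_ \oc c'); apply: (SX W).2.
  rewrite nE -n'E fmap_comp -compA -[RHS]compA shift_arrowE Ea /shift_arrow.
  by rewrite fmap_comp -[unshift _ \oc _ \oc _]compA.
by rewrite (dist_comp0_third dL) comp0r.
Qed.

(** Existence form of [universal_cone]: the objects admitting a universal
    arrow to [G] are closed under cones. *)
Lemma universal_cone_ex (X Y Z : C) (LX LY : D) (u : hom X Y) (v : hom Y Z)
    (w : hom Z (shift X)) (etaX : hom X (G LX)) (etaY : hom Y (G LY))
    (a : hom LX LY) :
  dist u v w -> universal_arrow etaX -> universal_arrow etaY ->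
  fmap G a \oc etaX = etaY \oc u ->
  exists LZ (c : hom LY LZ) (c' : hom LZ (shift LX)) (h : hom Z (G LZ)),
    [/\ dist a c c', universal_arrow h, h \oc v = fmap G c \oc etaY
      & fmap G c' \oc h = shift_arrow etaX \oc w].
Proof.
move=> d UX UY Ea; have [LZ [c [c' dL]]] := dist_cone a.
have [h [hE1 hE2]] := dist_fill d (tri_functor_dist G dL) (esym Ea).
have hE : fmap G c' \oc h = shift_arrow etaX \oc w.
  apply: (iso_mono (tri_functor_shift_iso G LX)).
  by rewrite compA -hE2 /shift_arrow !compA shift_unshift comp_idl.
exists LZ, c, c', h; split=> //.
exact: (universal_cone d dL UX UY Ea hE1 hE).
Qed.

(** The suspended unit [shift_arrow (eta X)] is universal like the unit at
    [shift X], which gives the comparison of [F] with the shift.  The cone of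
    [fmap F u] carries a universal arrow from the cone of [u] by
    [universal_cone], so it is [F] applied to the latter. *)
Lemma left_adjoint_triangle (F : functor C D) :
  adjoint F G -> exists F' : triangle_functor C D, tri_functor F' = F.
Proof.
move=> adjFG; have addF := left_adjoint_additive adjFG
  (@tri_functor_additive _ _ G).
have [eta [etaN etaU]] := adjoint_universal adjFG.
have H X : exists s : hom (F (shift X)) (shift (F X)), is_iso s /\
    fmap G s \oc eta (shift X) = shift_arrow (eta X).
  exact: universal_arrow_unique (etaU _) (universal_shift (etaU X)).
pose s X := sval (cid (H X)).
have sI X : is_iso (s X) by rewrite /s; case: cid => ? [].
have sE X : fmap G (s X) \oc eta (shift X) = shift_arrow (eta X).
  by rewrite /s; case: cid => ? [].
have sN X Y (f : hom X Y) : s Y \oc fmap F (fmap shift f) =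
    fmap shift (fmap F f) \oc s X.
  apply: (etaU _ _).2.
  rewrite !fmap_comp -!compA -etaN sE shift_arrowE -etaN compA sE.
  by rewrite /shift_arrow fmap_comp compA.
have sD X Y Z (u : hom X Y) (v : hom Y Z) (w : hom Z (shift X)) :
    dist u v w -> dist (fmap F u) (fmap F v) (s X \oc fmap F w).
  move=> d.
  have [L [c [c' [h [dL hU hE hE']]]]] :=
    universal_cone_ex d (etaU X) (etaU Y) (esym (etaN _ _ u)).
  have [k [kI kE]] := universal_arrow_unique hU (etaU Z).
  apply: (dist_iso dL (a := idm _) (b := idm _) (c := k)) => //.
  - exact: is_iso_id.
  - exact: is_iso_id.
  - by rewrite comp_idl comp_idr.
  - rewrite comp_idr; apply: (etaU Y _).2.
    by rewrite fmap_comp -compA -hE compA kE etaN.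
  - rewrite fmap_id comp_idl; apply: (hU _).2.
    by rewrite !fmap_comp -!compA kE -etaN [RHS]compA sE.
by exists (TriangleFunctor addF sI sN sD).
Qed.

(** The five lemma for [f |-> fmap G f \oc eta] along a triangle of targets. *)
Lemma represents_cone (X : C) (L : D) (eta : hom X (G L)) (Y1 Y2 Y3 : D)
    (u : hom Y1 Y2) (v : hom Y2 Y3) (w : hom Y3 (shift Y1)) :
  dist u v w -> represents eta Y1 -> represents eta Y2 ->
  represents eta (shift Y1) -> represents eta (shift Y2) -> represents eta Y3.
Proof.
move=> d R1 R2 R3 R4; have dG := tri_functor_dist G d.
have addG := @tri_functor_additive _ _ G.
split=> [g|]; last apply: represents_inj => // f f0.
  have [h hE] := R3.1 (fmap G w \oc g).
  have [k kE] : exists k : hom L Y3, h = w \oc k.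
    apply: (dist_weak_ker_third d); apply: (represents0 addG R4).
    by rewrite fmap_comp -compA hE compA -fmap_comp (dist_comp0_third d)
               tri_fmap0 comp0l.
  have [m mE] : exists m : hom X (G Y2), g - fmap G k \oc eta = fmap G v \oc m.
    apply: (dist_weak_ker_second dG).
    by rewrite -compA compBr [fmap G w \oc (_ \oc _)]compA -fmap_comp -kE hE
               subrr comp0r.
  have [m' m'E] := R2.1 m.
  exists (k + v \oc m'); rewrite addG compDl fmap_comp -compA m'E -mE.
  by rewrite addrC subrK.
have [f' fE] : exists f' : hom L Y2, f = v \oc f'.
  apply: (dist_weak_ker_second d); apply: (represents0 addG R3).
  by rewrite fmap_comp -compA f0 comp0r.
have [m mE] : exists m : hom X (G Y1), fmap G f' \oc eta = fmap G u \oc m.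
  by apply: (dist_weak_ker dG); rewrite compA -fmap_comp -fE.
have [m' m'E] := R1.1 m.
have -> : f = v \oc (u \oc m').
  rewrite fE; congr (_ \oc _); apply: R2.2.
  by rewrite mE -m'E fmap_comp compA.
by rewrite compA (dist_comp0 d) comp0l.
Qed.

End UniversalTriangles.

(** * Compactly generated categories are generated by coproducts and cones *)

Section Coproducts.

Lemma coproduct_ext (C : category) (I : Set) (Y : I -> C) (P Z : C)
    (inj : forall i, hom (Y i) P) (f g : hom P Z) :
  is_coproduct inj -> (forall i, f \oc inj i = g \oc inj i) -> f = g.
Proof.
move=> injP E; have [h [_ U]] := injP Z (fun i => g \oc inj i).
by rewrite -(U g) // -(U f).
Qed.

Lemma coproduct_desc (C : category) (I : Set) (Y : I -> C) (P Z : C)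
    (inj : forall i, hom (Y i) P) (f : forall i, hom (Y i) Z) :
  is_coproduct inj -> exists h : hom P Z, forall i, h \oc inj i = f i.
Proof. by move=> injP; have [h [hE _]] := injP Z f; exists h. Qed.

Lemma compact_coproduct_eq0 (C : preadditive) (I : Set) (Y : I -> C) (P X : C)
    (inj : forall i, hom (Y i) P) (pr : forall i, hom P (Y i)) (f : hom X P) :
  compact X -> is_coproduct inj ->
  (forall i, pr i \oc inj i = idm (Y i)) ->
  (forall i j, i <> j -> pr j \oc inj i = 0) ->
  (forall i, pr i \oc f = 0) -> f = 0.
Proof.
move=> /compactP cX injP prI prI0 f0.
have [s [_ [_ ->]]] := fin_factor_supports prI prI0 (cX _ _ _ _ injP f).
by rewrite big1 // => i _; rewrite f0 comp0r.
Qed.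

End Coproducts.

Section Telescope.
Variables (T : preadditive) (W : nat -> T) (s : forall k, hom (W k) (W k.+1)).
Variables (P : T) (inj : forall k, hom (W k) P).
Hypothesis injP : is_coproduct inj.
Variable sigma : hom P P.
Hypothesis sigmaE : forall k, sigma \oc inj k = inj k.+1 \oc s k.

(** A map [m] with [sigma \oc m = m] has component [0] in [W 0], because
    [sigma] never hits that summand, and then in [W 1], [W 2], and so on. *)
Lemma telescope_injective (X : T) (m : hom X P) :
  compact X -> (idm P - sigma) \oc m = 0 -> m = 0.
Proof.
move=> cX; rewrite compBl comp_idl => /eqP; rewrite subr_eq0 => /eqP E.
have [pr [prI prI0]] := coproduct_projections injP.
apply: (compact_coproduct_eq0 cX injP prI prI0).
elim=> [|k IH]; rewrite E compA.
  suff -> : pr 0 \oc sigma = 0 by rewrite comp0l.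
  apply: (coproduct_ext injP) => k; rewrite -compA sigmaE compA prI0 //.
  by rewrite !comp0l.
suff -> : pr k.+1 \oc sigma = s k \oc pr k by rewrite -compA IH comp0r.
apply: (coproduct_ext injP) => j; rewrite -!compA sigmaE compA.
have [-> | jk] := pselect (j = k); first by rewrite !prI comp_idl comp_idr.
by rewrite !prI0 ?comp0r ?comp0l // => -[].
Qed.

(** Modulo the image of [1 - sigma], the summand [W k] can be pushed into
    [W k.+1], so that a finite sum ends up in one summand. *)
Lemma telescope_finite (X : T) (f : hom X P) : compact X ->
  exists k (g : hom X (W k)) (m : hom X P),
    f = inj k \oc g + (idm P - sigma) \oc m.
Proof.
pose Q (f : hom X P) N := exists (g : hom X (W N)) (m : hom X P),
  f = inj N \oc g + (idm P - sigma) \oc m.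
have QS f0 N : Q f0 N -> Q f0 N.+1.
  move=> [g [m ->]]; exists (s N \oc g), (m + inj N \oc g).
  have -> : (idm P - sigma) \oc (m + inj N \oc g) =
      (idm P - sigma) \oc m + (inj N \oc g - inj N.+1 \oc (s N \oc g)).
    rewrite compDr (compBl _ _ (inj N \oc g)) comp_idl (compA sigma) sigmaE.
    by rewrite compA.
  by rewrite [RHS]addrCA [X in _ = _ + X]addrC subrK addrC.
have QD f0 N d : Q f0 N -> Q f0 (d + N)%N by move=> Qf; elim: d => //= d /QS.
move=> /compactP cX; have [t [g ->]] := cX _ _ _ _ injP f.
suff [N QN] : exists N, Q (\sum_(i <- t) inj i \oc g i) N by exists N.
elim: t => [|i t [N QN]].
  by exists 0%N; rewrite big_nil; exists 0, 0; rewrite !comp0r addr0.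
rewrite big_cons; exists (i + N)%N.
have [g1 [m1 ->]] := QD _ _ i QN.
have [g2 [m2 ->]] : Q (inj i \oc g i) (i + N)%N.
  rewrite addnC; apply: QD; exists (g i), 0; by rewrite comp0r addr0.
by exists (g2 + g1), (m2 + m1); rewrite !compDr addrACA.
Qed.

End Telescope.

Section Generation.
Variable T : triangulated.
Hypothesis T_cg : compactly_generated T.

Lemma compact_desuspend (X Y : T) (f : hom X (shift Y)) : compact X ->
  exists (X' : T) (t : hom (shift X') X) (m : hom X' Y),
    [/\ compact X', is_iso t & f \oc t = fmap shift m].
Proof.
move=> cX; have [X' [t tI]] := shift_surjective X.
have [m mE] := shift_full (f \oc t); exists X', t, m; split=> //.
by apply/compact_shift; apply: compact_iso cX; apply: isomorphic_sym; exists t.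
Qed.

Variable P : T -> Prop.
Hypothesis P_compact : forall X, compact X -> P X.
Hypothesis P_iso : forall X Y, isomorphic X Y -> P X -> P Y.
Hypothesis P_cone : forall (X Y Z : T) (u : hom X Y) (v : hom Y Z)
  (w : hom Z (shift X)), dist u v w -> P X -> P Y -> P Z.
Hypothesis P_coproduct : forall (I : Set) (Y : I -> T) (Q : T)
  (inj : forall i, hom (Y i) Q), is_coproduct inj -> (forall i, P (Y i)) -> P Q.

(** The maps to [Y] from representatives of the compact objects form a small
    family, and [K] is the coproduct of their sources. *)
Lemma compact_precover (Y : T) : exists (K : T) (k : hom K Y), P K /\
  forall C (f : hom C Y), compact C -> exists f', f = k \oc f'.
Proof.
have [T_coprod [I [G GP]] _] := T_cg.
pose J : Set := {i : I & hom (sval (G i)) Y}.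
have [K [inj injK]] := T_coprod J (fun j => sval (G (projT1 j))).
have [k kE] := coproduct_desc (fun j : J => projT2 j) injK.
exists K, k; split.
  by apply: (P_coproduct injK) => j; apply: P_compact; apply: (svalP (G _)).
move=> C f cC; have [i [a [b [ba ab]]]] := GP (exist _ C cC).
exists (inj (existT _ i (f \oc a)) \oc b).
by rewrite compA kE /= -compA; rewrite /= in ab; rewrite ab comp_idr.
Qed.

(** The kernel of [hom C W -> hom C Y] comes from the cocone of [t], so it dies
    in the cone of a map to [W] from a precover of this cocone. *)
Lemma compact_approximation_step (Y W : T) (t : hom W Y) : P W ->
  exists (W' : T) (t' : hom W' Y) (s : hom W W'),
    [/\ P W', t' \oc s = t
      & forall C (g : hom C W), compact C -> t \oc g = 0 -> s \oc g = 0].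
Proof.
move=> PW; have [K0 [k0 [k1 dK]]] := dist_cocone t.
have [K [k [PK kP]]] := compact_precover K0.
have [W' [s [s' dW]]] := dist_cone (k0 \oc k).
have [t' t'E] : exists t', t = t' \oc s.
  by apply: (dist_weak_coker dW); rewrite compA (dist_comp0 dK) comp0l.
exists W', t', s; split=> // [|C g cC tg]; first exact: P_cone dW PK PW.
have [g' ->] := dist_weak_ker dK tg; have [g'' ->] := kP _ g' cC.
by rewrite (compA k0) compA (dist_comp0 dW) comp0l.
Qed.

(** A homotopy colimit of approximations of [Y] by objects of [P] has the same
    maps from compact objects as [Y], so it is isomorphic to [Y]. *)
Theorem compactly_generated_ind (Y : T) : P Y.
Proof.
have [T_coprod _ T_gen] := T_cg.
have [W0 [t0 [PW0 W0P]]] := compact_precover Y.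
pose stage := {W : T & {t : hom W Y | P W}}.
pose obj (a : stage) : T := projT1 a.
pose map (a : stage) : hom (obj a) Y := sval (projT2 a).
pose linked (a b : stage) := exists s : hom (obj a) (obj b),
  map b \oc s = map a /\
  forall C (g : hom C (obj a)), compact C -> map a \oc g = 0 -> s \oc g = 0.
have nextP a : exists b, linked a b.
  case: a => W [t PW]; have [W' [t' [s [PW' E H]]]] :=
    compact_approximation_step t PW.
  by exists (existT _ W' (exist _ t' PW')), s.
pose st := fix st n : stage :=
  if n is m.+1 then sval (cid (nextP (st m))) else existT _ W0 (exist _ t0 PW0).
have stP n : linked (st n) (st n.+1) by rewrite /=; case: cid.
pose s n := sval (cid (stP n)).
have sE n : map (st n.+1) \oc s n = map (st n).
  by rewrite /s; case: (cid (stP n)) => s' [].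
have sK n C (g : hom C (obj (st n))) : compact C ->
    map (st n) \oc g = 0 -> s n \oc g = 0.
  by rewrite /s; case: (cid (stP n)) => s' [sE' H]; apply: H.
have Pst n : P (obj (st n)) by case: (st n) => W [t PW].
have [Q [inj injQ]] := T_coprod nat (fun n => obj (st n)).
have [sg sgE] := coproduct_desc (fun n => inj n.+1 \oc s n) injQ.
have [H [v [w dH]]] := dist_cone (idm Q - sg).
have [tQ tQE] := coproduct_desc (fun n => map (st n)) injQ.
have [t tE] : exists t, tQ = t \oc v.
  apply: (dist_weak_coker dH); apply: (coproduct_ext injQ) => n.
  by rewrite -compA compBl comp_idl compBr sgE compA !tQE sE subrr comp0l.
have PQ : P Q by exact: (P_coproduct injQ Pst).
have PH : P H by exact: (P_cone dH PQ PQ).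
have surj C (f : hom C Y) : compact C -> exists f', f = t \oc f'.
  move=> cC; have [f' ->] := W0P _ f cC; exists (v \oc (inj 0 \oc f')).
  by rewrite !compA -tE tQE.
have inj0 C (f : hom C H) : compact C -> t \oc f = 0 -> f = 0.
  move=> cC tf.
  have wf : w \oc f = 0.
    have [C' [th [m [cC' thI mE]]]] := compact_desuspend (w \oc f) cC.
    apply: (iso_epi thI); rewrite mE comp0l.
    suff -> : m = 0 by rewrite shift0.
    apply: (telescope_injective injQ sgE cC').
    apply: shift_faithful; rewrite shift0 fmap_comp -mE !compA.
    by rewrite (dist_comp0_third dH) !comp0l.
  have [f' fE] := dist_weak_ker_second dH wf.
  have [n [g [m f'E]]] := telescope_finite injQ sgE f' cC.
  have fE' : f = v \oc inj n \oc g.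
    by rewrite fE f'E compDr !compA (dist_comp0 dH) comp0l addr0.
  have /(sK _ _ _ cC) sg0 : map (st n) \oc g = 0.
    by rewrite -tQE tE -!compA (compA v) -fE'.
  have : v \oc ((idm Q - sg) \oc inj n \oc g) = 0.
    by rewrite !compA (dist_comp0 dH) !comp0l.
  rewrite compBl comp_idl sgE compBl -(compA (inj n.+1)).
  by rewrite sg0 comp0r subr0 compA -fE'.
have [Z [v' [w' dZ]]] := dist_cone t.
have /(dist_zero_cone dZ) tI : is_zero Z.
  apply: T_gen => C cC g.
  have wg : w' \oc g = 0.
    have [C' [th [m [cC' thI mE]]]] := compact_desuspend (w' \oc g) cC.
    apply: (iso_epi thI); rewrite mE comp0l.
    suff -> : m = 0 by rewrite shift0.
    apply: (inj0 _ m cC').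
    apply: shift_faithful; rewrite shift0 fmap_comp -mE !compA.
    by rewrite (dist_comp0_third dZ) !comp0l.
  have [g' ->] := dist_weak_ker_second dZ wg; have [g'' ->] := surj _ g' cC.
  by rewrite compA (dist_comp0 dZ) comp0l.
by apply: P_iso PH; exists t.
Qed.

End Generation.

(** * Extending left adjoints from compact objects *)

Section LeftAdjointFromCompacts.
Variables (C D : triangulated) (F : triangle_functor D C).

(** Maps from [X] to [F P] and from [L] to [P] are finite sums of maps into the
    summands. *)
Lemma represents_coproduct (X : C) (L : D) (eta : hom X (F L)) (I : Set)
    (Y : I -> D) (P : D) (inj : forall i, hom (Y i) P) :
  preserves_coproducts F -> compact X -> compact L -> is_coproduct inj ->
  (forall i, represents eta (Y i)) -> represents eta P.
Proof.
move=> coF /compactP cX cL injP R.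
have addF := @tri_functor_additive _ _ F.
split=> [g|]; last apply: represents_inj => // f f0.
  have [s [h ->]] := cX _ _ _ _ (coF _ _ _ _ injP) g.
  pose k i := sval (cid ((R i).1 (h i))).
  have kE i : fmap F (k i) \oc eta = h i by rewrite /k; case: cid.
  exists (\sum_(i <- s) inj i \oc k i).
  rewrite (additive_fmap_sum addF) comp_suml; apply: eq_bigr => i _.
  by rewrite fmap_comp -compA kE.
have [pr [prI prI0]] := coproduct_projections injP.
apply: (compact_coproduct_eq0 cL injP prI prI0) => i.
by apply: (represents0 addF (R i)); rewrite fmap_comp -compA f0 comp0r.
Qed.

(** Both sides of [hom L Y -> hom X (F Y)] are homological in [Y] and commute
    with coproducts. *)
Lemma universal_arrow_of_compact (X : C) (L : D) (eta : hom X (F L)) :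
  compactly_generated D -> preserves_coproducts F -> compact X -> compact L ->
  (forall Y, compact Y -> represents eta Y) -> universal_arrow eta.
Proof.
move=> D_cg coF cX cL RY Y; move: X L eta cX cL RY.
pose P (Y : D) := forall (X : C) (L : D) (eta : hom X (F L)), compact X ->
  compact L -> (forall Y, compact Y -> represents eta Y) -> represents eta Y.
(* An arrow tested at [shift Y0] is the suspension of one tested at [Y0]. *)
have PS Y0 : P Y0 -> P (shift Y0).
  move=> PY X L eta cX cL RY.
  have [X' [t tI]] := shift_surjective X.
  have [L' [b bI]] := shift_surjective L; have [b' [b'b bb']] := bI.
  have [eta' eta'E] :=
    shift_full (tri_functor_shift F L' \oc (fmap F b' \oc eta \oc t)).
  have E : eta \oc t = fmap F b \oc shift_arrow eta'.
    rewrite /shift_arrow eta'E (compA (unshift _ _)) unshiftK comp_idl !compA.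
    by rewrite -fmap_comp bb' fmap_id comp_idl.
  have RE Z := represents_source_iso Z tI bI E.
  have cX' : compact X'.
    apply/compact_shift; apply: compact_iso cX.
    by apply: isomorphic_sym; exists t.
  have cL' : compact L'.
    apply/compact_shift; apply: compact_iso cL.
    by apply: isomorphic_sym; exists b.
  apply: (RE _).1; apply: (represents_shift _ _).1; apply: PY => // Z cZ.
  apply: (represents_shift _ _).2; apply: (RE _).2; apply: RY.
  by have [S _] := compact_shift Z; apply: S.
apply: (compactly_generated_ind D_cg (P := P)).
- by move=> Z cZ X L eta _ _; apply.
- move=> Z Z' ZZ' PZ X L eta cX cL RY.
  by apply: (represents_target_iso ZZ'); apply: PZ.
- move=> Y1 Y2 Y3 u v w d P1 P2 X L eta cX cL RY.
  apply: (represents_cone d); [exact: P1|exact: P2|..].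
    by apply: (PS Y1).
  by apply: (PS Y2).
- move=> I Z Q inj injQ PZ X L eta cX cL RY.
  by apply: (represents_coproduct coF cX cL injQ) => i; apply: PZ.
Qed.

Lemma universal_coproduct (I : Set) (X : I -> C) (Q : C)
    (inj : forall i, hom (X i) Q) :
  has_small_coproducts D -> is_coproduct inj ->
  (forall i, exists L (eta : hom (X i) (F L)), universal_arrow eta) ->
  exists L (eta : hom Q (F L)), universal_arrow eta.
Proof.
move=> D_coprod injQ H.
pose L i := sval (cid (H i)).
have H1 i : exists eta : hom (X i) (F (L i)), universal_arrow eta.
  by rewrite /L; case: cid.
pose eta i := sval (cid (H1 i)).
have etaU i : universal_arrow (eta i) by rewrite /eta; case: cid.
have [M [injM injMP]] := D_coprod I L.
have [mu muE] := coproduct_desc (fun i => fmap F (injM i) \oc eta i) injQ.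
exists M, mu => Y; split=> [g|f f' E].
  pose k i := sval (cid ((etaU i Y).1 (g \oc inj i))).
  have kE i : fmap F (k i) \oc eta i = g \oc inj i by rewrite /k; case: cid.
  have [f fE] := coproduct_desc k injMP.
  exists f; apply: (coproduct_ext injQ) => i.
  by rewrite -compA muE compA -fmap_comp fE kE.
apply: (coproduct_ext injMP) => i; apply: (etaU i Y).2.
by rewrite !fmap_comp -!compA -muE !compA E.
Qed.

(** The objects of [C] with a universal arrow to [F] form a localizing
    subcategory, so it suffices to have them for the compact objects. *)
Theorem left_adjoint_of_compacts (cF : preserves_compact F)
    (L : functor (compacts C) (compacts D)) :
  compactly_generated C -> compactly_generated D -> preserves_coproducts F ->
  adjoint L (restrict_compacts cF) -> exists F', adjoint F' F.
Proof.
move=> C_cg D_cg coF /adjoint_universal[eta [_ etaU]].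
apply: universal_adjoint; apply: (compactly_generated_ind C_cg).
- move=> X cX; exists (sval (L (exist _ X cX))), (eta (exist _ X cX)).
  apply: universal_arrow_of_compact => // [|Y cY]; first exact: svalP (L _).
  exact: etaU (exist _ X cX) (exist _ Y cY).
- move=> X Y XY [M [mu muU]]; have [f [g [gf fg]]] := isomorphic_sym XY.
  exists M, (mu \oc f) => Z.
  apply: (represents_source_iso (a := g) (b := idm M) Z _ _ _).1 (muU Z).
  + by exists f.
  + exact: is_iso_id.
  + by rewrite -compA fg comp_idr fmap_id comp_idl.
- move=> X Y Z u v w d [M [mu muU]] [N [nu nuU]].
  have [a aE] := (muU N).1 (nu \oc u).
  have [K [_ [_ [h [_ hU _ _]]]]] := universal_cone_ex d muU nuU aE.
  by exists K, h.
- have [D_coprod _ _] := D_cg.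
  by move=> I Y Q inj injQ; apply: universal_coproduct.
Qed.

End LeftAdjointFromCompacts.

Lemma restrict_adjoint (C D : triangulated) (F : triangle_functor C D)
    (G : triangle_functor D C) (cF : preserves_compact F)
    (cG : preserves_compact G) :
  adjoint F G -> adjoint (restrict_compacts cF) (restrict_compacts cG).
Proof.
move=> [phi [phiB phiN]]; exists (fun X Y => phi (sval X) (sval Y)).
split=> [X Y|X' X Y Y' h f g]; first exact: phiB.
exact: phiN.
Qed.

Lemma restrict_fully_faithful (C D : triangulated) (F : triangle_functor C D)
    (cF : preserves_compact F) :
  fully_faithful F -> fully_faithful (restrict_compacts cF).
Proof. by move=> ff X Y; apply: ff. Qed.

(** * Stable t-structures and halves of recollements *)

Section Orthogonality.

Lemma adjoint_hom0l (C D : preadditive) (F : functor C D) (G : functor D C)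
    (X : C) (Y : D) (f : hom X (G Y)) :
  adjoint F G -> is_additive_functor G -> is_zero (F X) -> f = 0.
Proof.
move=> /adjoint_universal[eta [_ etaU]] addG [X0 _].
have [g <-] := (etaU X Y).1 f.
by rewrite (X0 _ g) (additive_fmap0 addG) comp0l.
Qed.

Lemma adjoint_hom0r (C D : preadditive) (F : functor C D) (G : functor D C)
    (X : C) (Y : D) (f : hom (F X) Y) :
  adjoint F G -> is_additive_functor G -> is_zero (G Y) -> f = 0.
Proof.
move=> /adjoint_universal[eta [_ etaU]] addG [_ Y0].
apply: (represents0 addG (etaU X Y)); exact: Y0.
Qed.

Variables (C D : triangulated) (F : triangle_functor C D).
Variables (G : triangle_functor D C).
Hypothesis adjFG : adjoint F G.

(** By the triangle identities [fmap F eta] is inverse to a counit, which is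
    invertible when [G] is fully faithful. *)
Lemma unit_cocone_zero (X : C) : fully_faithful G ->
  exists (K : C) (L : D) (k : hom K X) (eta : hom X (G L))
    (w : hom (G L) (shift K)),
    [/\ dist k eta w, universal_arrow eta & is_zero (F K)].
Proof.
move=> ffG; have [eta [eps [etaN epsN Feta Geps]]] := adjoint_unit_counit adjFG.
have [K [k [w d]]] := dist_cocone (eta X).
exists K, (F X), k, (eta X), w; split=> //.
  exact: (unit_universal etaN epsN Feta Geps).
apply/(dist_zero_cocone (tri_functor_dist F d)).
have [e [e1 e2]] := adjoint_counit_iso epsN Feta Geps ffG (F X).
exists (eps (F X)); split; first exact: Feta.
have -> : fmap F (eta X) = e by rewrite -[LHS]comp_idl -e1 -compA Feta comp_idr.
exact: e1.
Qed.

Lemma counit_cone_zero (Y : D) : fully_faithful F ->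
  exists (L : C) (Z : D) (eps : hom (F L) Y) (v : hom Y Z)
    (w : hom Z (shift (F L))), dist eps v w /\ is_zero (G Z).
Proof.
move=> ffF; have [eta [eps [etaN epsN Feta Geps]]] := adjoint_unit_counit adjFG.
have [Z [v [w d]]] := dist_cone (eps Y).
exists (G Y), Z, (eps Y), v, w; split=> //.
apply/(dist_zero_cone (tri_functor_dist G d)).
have [e [e1 e2]] := adjoint_unit_iso etaN Feta Geps ffF (G Y).
exists (eta (G Y)); split; last exact: Geps.
have -> : fmap G (eps Y) = e by rewrite -[LHS]comp_idr -e2 compA Geps comp_idl.
exact: e2.
Qed.

End Orthogonality.

Section StableTStructures.
Variable T : triangulated.

Lemma left_class_orthogonal (X Y : T -> Prop) (A : T) :
  stable_t_structure X Y ->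
  X A <-> (forall B, Y B -> forall f : hom A B, f = 0).
Proof.
move=> [tX tY XY H]; split=> [XA B YB f|A0]; first exact: XY XA YB f.
have [A' [B [u [v [w [XA' YB d]]]]]] := H A.
apply: (sub_iso tX _ XA'); exists u; apply/(dist_zero_cone d)/is_zeroP.
(* [B] is a direct summand of [shift A'], because [v = 0]. *)
have [g ->] : exists g, idm B = g \oc w.
  by apply: (dist_weak_coker_second d); rewrite (A0 _ YB v) comp0r.
by rewrite (XY _ _ ((sub_shift tX A').1 XA') YB g) comp0l.
Qed.

Lemma left_class_unique (X Y X' Y' : T -> Prop) :
  stable_t_structure X Y -> stable_t_structure X' Y' ->
  (forall A, Y A <-> Y' A) -> forall A, X A <-> X' A.
Proof.
move=> S S' E A; split.
  move=> /(left_class_orthogonal A S) H; apply/(left_class_orthogonal A S').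
  by move=> B /E; apply: H.
move=> /(left_class_orthogonal A S') H; apply/(left_class_orthogonal A S).
by move=> B /E; apply: H.
Qed.

Variables (V : triangulated) (F : triangle_functor V T).
Hypothesis ffF : fully_faithful F.

(** Every map [Z -> F Y] factors uniquely through [v], since neither [A] nor
    [shift A] has maps to the image of [F]; so [v] is a universal arrow. *)
Lemma left_adjoint_of_truncations :
  (forall Z : T, exists (A : T) (B : V) (u : hom A Z) (v : hom Z (F B))
     (w : hom (F B) (shift A)),
     dist u v w /\ forall B' (f : hom A (F B')), f = 0) ->
  exists L, adjoint L F.
Proof.
move=> H; apply: universal_adjoint => Z.
have [A [B [u [v [w [d A0]]]]]] := H Z.
exists B, v => Y; split=> [g|]; last first.
  apply: (represents_inj (@tri_functor_additive _ _ F)) => f f0.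
  have [m mE] := dist_weak_coker_second d f0.
  apply: (bij_inj (ffF _ _)); rewrite tri_fmap0 mE.
  suff -> : m = 0 by rewrite comp0l.
  have [Y' YY'] := shift_surjective Y.
  have /isomorphic_sym [t tI] : isomorphic (shift (F Y')) (F Y).
    apply: isomorphic_trans (isomorphic_fmap F YY').
    exact: isomorphic_sym (tri_shift_isomorphic F Y').
  have [m' m'E] := shift_full (t \oc m).
  by apply: (iso_mono tI); rewrite -m'E (A0 _ m') shift0 comp0r.
have [g' ->] : exists g', g = g' \oc v by apply: (dist_weak_coker d); apply: A0.
by have [Fi FiK FKi] := ffF B Y; exists (Fi g'); rewrite FKi.
Qed.

Lemma left_adjoint_of_t_structure (X Y : T -> Prop) :
  stable_t_structure X Y -> (forall A, Y A <-> ess_image F A) ->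
  exists L, adjoint L F.
Proof.
move=> [tX tY XY H] E; apply: left_adjoint_of_truncations => Z.
have [A [B [u [v [w [XA /E[B' [t tI]] d]]]]]] := H Z.
have [t' [t't tt']] := tI.
exists A, B', u, (t' \oc v), (w \oc t); split.
  apply: (dist_iso d (is_iso_id A) (is_iso_id Z) (c := t')).
  - by exists t.
  - by rewrite comp_idl comp_idr.
  - by rewrite comp_idr.
  - by rewrite fmap_id comp_idl -compA tt' comp_idr.
move=> B'' f; apply: (XY _ _ XA); apply/E.
by exists B''; apply: isomorphic_refl.
Qed.

End StableTStructures.

(** Two consecutive rows of a ladder.  A recollement consists of two of these
    sharing their middle row, and so a ladder is determined by its pairs of
    consecutive rows. *)
Record half_recollement (U T V : triangulated)
    (q : triangle_functor T U) (i : triangle_functor U T)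
    (l : triangle_functor V T) (e : triangle_functor T V) : Prop :=
  HalfRecollement {
    half_qi : adjoint q i;
    half_le : adjoint l e;
    half_i : fully_faithful i;
    half_l : fully_faithful l;
    half_ker : forall X : T, ess_image i X <-> is_zero (e X)
  }.

Section HalfRecollements.
Variables (U T V : triangulated).
Variables (q : triangle_functor T U) (i : triangle_functor U T).
Variables (l : triangle_functor V T) (e : triangle_functor T V).

Section OneHalf.
Hypothesis H : half_recollement q i l e.

Let add_i := @tri_functor_additive _ _ i.
Let add_e := @tri_functor_additive _ _ e.

Lemma half_ei0 (X : U) : is_zero (e (i X)).
Proof. by apply/(half_ker H); exists X; apply: isomorphic_refl. Qed.

Lemma half_hom0 (X : V) (Y : U) (f : hom (l X) (i Y)) : f = 0.
Proof. exact: adjoint_hom0r (half_le H) add_e (half_ei0 Y). Qed.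

Lemma half_ql0 (X : V) : is_zero (q (l X)).
Proof.
have [eta [etaN etaU]] := adjoint_universal (half_qi H).
apply/is_zeroP/(represents0 add_i (etaU (l X) _)); exact: half_hom0.
Qed.

(** If [q X] vanishes, then so does the map from [X] to its part in the image of
    [i].  That part is then a direct summand of an object in the image of [l],
    from which there are no maps to the image of [i], so it is zero. *)
Lemma half_ker_q (X : T) : ess_image l X <-> is_zero (q X).
Proof.
split=> [[Y YX]|X0].
  exact: is_zero_iso (isomorphic_fmap q YX) (half_ql0 Y).
have [L [Z [a [v [w [d Z0]]]]]] := counit_cone_zero (half_le H) X (half_l H).
move: Z0 => /(half_ker H)[Y [t [t' [t't tt']]]].
exists L, a; apply/(dist_zero_cone d)/is_zeroP.
have v0 : v = 0.
  rewrite -[v]comp_idl -tt' -compA; set f := t' \oc v.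
  by rewrite (adjoint_hom0l f (half_qi H) add_i X0) comp0r.
have [g gE] : exists g, idm Z = g \oc w.
  by apply: (dist_weak_coker_second d); rewrite v0 comp0r.
suff g0 : g = 0 by rewrite gE g0 comp0l.
have [s sI] := tri_shift_isomorphic l L.
have t'I : is_iso t' by exists t.
apply: (iso_epi sI); apply: (iso_mono t'I).
by rewrite comp0l comp0r (half_hom0 (t' \oc _)).
Qed.

Lemma half_stable : stable_t_structure (ess_image l) (ess_image i).
Proof.
have E1 : ess_image l = (fun X => is_zero (q X)).
  by apply/funext => X; apply/propext/half_ker_q.
have E2 : ess_image i = (fun X => is_zero (e X)).
  by apply/funext => X; apply/propext/(half_ker H).
split.
- by rewrite E1; apply: kernel_triangulated.
- by rewrite E2; apply: kernel_triangulated.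
- move=> A B [X [t tI]] [Y [s sI]] f; have [s' [s's ss']] := sI.
  apply: (iso_epi tI); rewrite comp0l -[f]comp_idl -ss' -!compA.
  by rewrite (half_hom0 (s' \oc _)) comp0r.
- move=> Z.
  have [L [K [a [v [w [d /(half_ker H) K0]]]]]] :=
    counit_cone_zero (half_le H) Z (half_l H).
  by exists (l L), K, a, v, w; split=> //; exists L; apply: isomorphic_refl.
Qed.

Lemma half_up (l1 : triangle_functor T V) (q1 : triangle_functor U T) :
  adjoint l1 l -> adjoint q1 q -> half_recollement l1 l q1 q.
Proof.
move=> Hl Hq; split=> //; first exact: half_l H.
  exact: adjoint_triple_fully_faithful Hq (half_qi H) (half_i H).
exact: half_ker_q.
Qed.

(** For [u] in [U], the truncation of [i u] in the left orthogonal of the image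
    of [l] corepresents [hom u (q -)]: both [q] and [hom K -] for [K] in that
    orthogonal annihilate the image of [l]. *)
Lemma half_up_l : (exists l1, adjoint l1 l) ->
  exists (l1 : triangle_functor T V) (q1 : triangle_functor U T),
    half_recollement l1 l q1 q.
Proof.
move=> [l1' adj_l1]; have [l1 l1E] := left_adjoint_triangle adj_l1.
rewrite -l1E in adj_l1.
suff [q1' adj_q1] : exists q1', adjoint q1' q.
  have [q1 q1E] := left_adjoint_triangle adj_q1; rewrite -q1E in adj_q1.
  by exists l1, q1; apply: half_up.
apply: universal_adjoint => u.
have add_l := @tri_functor_additive _ _ l.
have [mu [eps [muN epsN qmu ieps]]] := adjoint_unit_counit (half_qi H).
have epsI := adjoint_counit_iso epsN qmu ieps (half_i H).
have [K [L [k [eta [w [d _ K0]]]]]] := unit_cocone_zero adj_l1 (i u) (half_l H).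
have K_orth Y (Y0 : ess_image l Y) (f : hom K Y) : f = 0.
  have [B [t [t' [t't tt']]]] := Y0; rewrite -[f]comp_idl -tt' -compA.
  by rewrite (adjoint_hom0l (t' \oc f) adj_l1 add_l K0) comp0r.
have aI : is_iso (eps u \oc fmap q k).
  apply: is_iso_comp (epsI u) _; have dq := tri_functor_dist q d.
  by apply/(dist_zero_cone dq); apply: half_ql0.
have [b [ba ab]] := aI.
exists K, b => Y.
(* [K] does not see the difference between [Y] and its reflection. *)
have [A [k' [w' dY]]] := dist_cocone (mu Y).
have tl : triangulated_subcategory (ess_image l) by case: half_stable.
have A0 : ess_image l A.
  apply/half_ker_q/(dist_zero_cocone (tri_functor_dist q dY)).
  have [c [ca ac]] := epsI (q Y); exists (eps (q Y)); split; first exact: qmu.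
  have -> : fmap q (mu Y) = c.
    by rewrite -[LHS]comp_idl -ca -compA qmu comp_idr.
  exact: ca.
have bI : is_iso b by exists (eps u \oc fmap q k).
split=> [g|]; last first.
  apply: (represents_inj (@tri_functor_additive _ _ q)) => f.
  rewrite -(comp0l _ b) => /(iso_epi bI) qf0.
  have [f' ->] : exists f', f = k' \oc f'.
    by apply: (dist_weak_ker dY); rewrite muN qf0 tri_fmap0 comp0l.
  by rewrite (K_orth _ A0 f') comp0r.
pose g' := g \oc (eps u \oc fmap q k).
have [f fE] : exists f, fmap i g' \oc mu K = mu Y \oc f.
  apply: (dist_weak_ker_second dY); apply: K_orth.
  by have [S _] := sub_shift tl A; apply: S.
exists f; suff -> : fmap q f = g' by rewrite /g' -compA ab comp_idr.
have muU := unit_universal muN epsN qmu ieps.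
by apply: (muU K _).2; rewrite -muN -fE.
Qed.

(** The counit [q1 (q Z) -> Z] becomes invertible under [q], so its cone lies in
    the kernel of [q], that is, in the image of [l]. *)
Lemma half_up_q : (exists q1, adjoint q1 q) ->
  exists (l1 : triangle_functor T V) (q1 : triangle_functor U T),
    half_recollement l1 l q1 q.
Proof.
move=> [q1' adj_q1]; have [q1 q1E] := left_adjoint_triangle adj_q1.
rewrite -q1E in adj_q1.
suff [l1' adj_l1] : exists l1', adjoint l1' l.
  have [l1 l1E] := left_adjoint_triangle adj_l1; rewrite -l1E in adj_l1.
  by exists l1, q1; apply: half_up.
have ff_q1 := adjoint_triple_fully_faithful adj_q1 (half_qi H) (half_i H).
apply: left_adjoint_of_truncations; first exact: half_l H.
move=> Z; have [L [C [a [v [w [d /half_ker_q[B [t tI]]]]]]]] :=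
  counit_cone_zero adj_q1 Z ff_q1.
have [t' [t't tt']] := tI.
exists (q1 L), B, a, (t' \oc v), (w \oc t); split.
  apply: (dist_iso d (is_iso_id _) (is_iso_id Z) (c := t')).
  - by exists t.
  - by rewrite comp_idl comp_idr.
  - by rewrite comp_idr.
  - by rewrite fmap_id comp_idl -compA tt' comp_idr.
move=> B' f; apply: (adjoint_hom0r f adj_q1 _ (half_ql0 B')).
exact: tri_functor_additive.
Qed.

End OneHalf.

(** Only the equality of the image of [r] with the kernel of [p] has to be added
    to the axioms of a recollement.  It holds since the cocone of [X -> r (e X)]
    lies in the image of [i], from which there are no maps to [X] if [p X]
    vanishes. *)
Lemma recollement_halves (p : triangle_functor T U) (r : triangle_functor V T) :
  is_recollement q i p l e r <->
  half_recollement q i l e /\ half_recollement e r i p.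
Proof.
split=> [[qi ip le er i_ff l_ff r_ff ker]
        |[[qi le i_ff l_ff ker] [er ip r_ff _ _]]];
  last by split.
have H : half_recollement q i l e by split.
split=> //; split=> // X.
have add_r := @tri_functor_additive _ _ r.
have add_p := @tri_functor_additive _ _ p.
have ir0 (Y : U) (Z : V) (f : hom (i Y) (r Z)) : f = 0.
  exact: adjoint_hom0l er add_r (half_ei0 H Y).
split=> [[Z ZX]|X0].
  apply: is_zero_iso (isomorphic_fmap p ZX) _; apply/is_zeroP.
  have [eta [eps [_ _ _ peps]]] := adjoint_unit_counit ip.
  by rewrite -peps (ir0 _ _ (eps _)) tri_fmap0 comp0l.
have [K [L [k [eta [w [d _ K0]]]]]] := unit_cocone_zero er X r_ff.
move: K0 => /ker[Y [t tI]].
exists L; apply: isomorphic_sym; exists eta.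
apply/(dist_zero_cocone d)/is_zeroP.
have k0 : k = 0.
  by apply: (iso_epi tI); rewrite comp0l; apply: (adjoint_hom0r _ ip).
apply: shift_faithful; rewrite shift0.
have [f ->] : exists f, fmap shift (idm K) = w \oc f.
  by apply: (dist_weak_ker_third d); rewrite k0 shift0 comp0l.
suff -> : f = 0 by rewrite comp0r.
have [s sI] := tri_shift_isomorphic i Y.
apply: (iso_epi (is_iso_fmap shift tI)); apply: (iso_epi sI).
by rewrite !comp0l; apply: ir0.
Qed.

End HalfRecollements.

(** * Rows of a ladder and their restriction to compact objects *)

Section CompactRestriction.

Lemma fully_faithful_reflects_compact (C D : triangulated)
    (F : triangle_functor C D) (X : C) :
  fully_faithful F -> preserves_coproducts F -> compact (F X) -> compact X.
Proof.
move=> ff coF /compactP cX; apply/compactP => I Y P inj injP f.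
have [s [g E]] := cX _ _ _ _ (coF _ _ _ _ injP) (fmap F f).
have gP i : exists k, fmap F k = g i.
  by have [Fi _ FKi] := ff X (Y i); exists (Fi (g i)).
pose k i := sval (cid (gP i)).
have kE i : fmap F (k i) = g i by rewrite /k; case: cid.
exists s, k; apply: (bij_inj (ff _ _)).
rewrite E (additive_fmap_sum (@tri_functor_additive _ _ F)).
by apply: eq_bigr => i _; rewrite fmap_comp kE.
Qed.

Lemma ess_image_restrict (C D : triangulated) (F : triangle_functor C D)
    (cF : preserves_compact F) (Y : compacts D) :
  fully_faithful F -> preserves_coproducts F ->
  ess_image (restrict_compacts cF) Y <-> ess_image F (sval Y).
Proof.
move=> ff coF; split=> [[X XY]|[X XY]]; first by exists (sval X).
have cX : compact X.
  apply: (fully_faithful_reflects_compact ff coF).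
  exact: compact_iso (isomorphic_sym XY) (svalP Y).
by exists (exist _ X cX).
Qed.

Lemma is_zero_compacts (T : triangulated) (X : compacts T) :
  is_zero X <-> is_zero (sval X).
Proof.
by split=> /is_zeroP E; apply/is_zeroP; exact: E.
Qed.

(** For compact [X] in the image of [i], a preimage of [X] is isomorphic to
    [q X], hence compact. *)
Lemma half_restrict (U T V : triangulated)
    (q : triangle_functor T U) (i : triangle_functor U T)
    (l : triangle_functor V T) (e : triangle_functor T V)
    (cq : preserves_compact q) (ci : preserves_compact i)
    (cl : preserves_compact l) (ce : preserves_compact e) :
  half_recollement q i l e ->
  half_recollement (restrict_compacts cq) (restrict_compacts ci)
    (restrict_compacts cl) (restrict_compacts ce).
Proof.
move=> H; split.
- exact: restrict_adjoint (half_qi H).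
- exact: restrict_adjoint (half_le H).
- exact: restrict_fully_faithful (half_i H).
- exact: restrict_fully_faithful (half_l H).
move=> X; split=> [[Y YX]|].
  apply/is_zero_compacts/(half_ker H (sval X)).
  by exists (sval Y).
move=> /is_zero_compacts/(half_ker H (sval X))[Y YX].
have [eta [eps [_ epsN qeta ieps]]] := adjoint_unit_counit (half_qi H).
have epsI := adjoint_counit_iso epsN qeta ieps (half_i H).
have cY : compact Y.
  apply: (compact_iso (X := q (i Y))); first by exists (eps Y); apply: epsI.
  apply: cq; exact: compact_iso (isomorphic_sym YX) (svalP X).
by exists (exist _ Y cY).
Qed.

Variables (U T V : triangulated).
Variables (q : triangle_functor T U) (i : triangle_functor U T).
Variables (l : triangle_functor V T) (e : triangle_functor T V).
Hypothesis H : half_recollement q i l e.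

Lemma half_up_t_structure (X Y : T -> Prop) :
  stable_t_structure X Y -> (forall C, Y C <-> ess_image l C) ->
  exists (l1 : triangle_functor T V) (q1 : triangle_functor U T),
    half_recollement l1 l q1 q /\ forall C, X C <-> ess_image q1 C.
Proof.
move=> S YE.
have [l1 [q1 H1]] := half_up_l H (left_adjoint_of_t_structure (half_l H) S YE).
exists l1, q1; split=> // C.
exact: left_class_unique S (half_stable H1) YE C.
Qed.

Hypotheses (T_cg : compactly_generated T) (V_cg : compactly_generated V).

(** Truncation yields a left adjoint of [l] on compact objects, which extends
    to [T].  The new left class is determined by the old right class, also on
    compact objects. *)
Lemma half_up_compact_t_structure (X Y : T -> Prop) :
  preserves_compact q -> preserves_compact l ->
  preserves_coproducts q -> preserves_coproducts l ->
  stable_t_structure (compact_part X) (compact_part Y) ->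
  (forall C, compact C -> Y C <-> ess_image l C) ->
  exists (l1 : triangle_functor T V) (q1 : triangle_functor U T),
    half_recollement l1 l q1 q /\
    forall C, compact C -> X C <-> ess_image q1 C.
Proof.
move=> cq cl coq col S YE.
have YE' (C : compacts T) : compact_part Y C <->
    ess_image (restrict_compacts cl) C.
  apply: iff_trans (YE _ (svalP C)) _; apply: iff_sym.
  exact: ess_image_restrict (half_l H) col.
have [L adjL] := left_adjoint_of_t_structure
  (restrict_fully_faithful cl (half_l H)) S YE'.
have [l1 [q1 H1]] := half_up_l H (left_adjoint_of_compacts T_cg V_cg col adjL).
exists l1, q1; split=> // C cC.
have addl1 := @tri_functor_additive _ _ l1.
have addq1 := @tri_functor_additive _ _ q1.
have cl1 : preserves_compact l1.
  by apply: adjoint_preserves_compact (half_qi H1) col _; left.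
have cq1 : preserves_compact q1.
  by apply: adjoint_preserves_compact (half_le H1) coq _; left.
have coq1 := adjoint_preserves_coproducts (half_le H1).
have S' := half_stable (half_restrict cl1 cl cq1 cq H1).
apply: iff_trans (left_class_unique S S' YE' (exist _ C cC)) _.
exact: (ess_image_restrict cq1 (exist _ C cC) (half_l H1) coq1).
Qed.

End CompactRestriction.

Section Rows.
Variables (U T V : triangulated).

Definition row_q (b : bool) : ladder_row U T V b -> alternating_functor T U b :=
  match b with
  | false => fun row => tri_functor row.1
  | true => fun row => tri_functor row.1
  end.

Definition row_l (b : bool) : ladder_row U T V b -> alternating_functor V T b :=
  match b with
  | false => fun row => tri_functor row.2
  | true => fun row => tri_functor row.2
  end.

(** The functors with target [T] alternate between the two columns. *)
Definition row_image (b : bool) : ladder_row U T V b -> T -> Prop :=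
  match b with
  | false => fun row => ess_image row.2
  | true => fun row => ess_image row.1
  end.

(** Over a row [(q, l)] the columns are exchanged, since its fully faithful
    functor is [l] and that of the next row is [q1]. *)
Definition half_rows (b : bool) :
    ladder_row U T V (~~ b) -> ladder_row U T V b -> Prop :=
  match b with
  | false => fun top bot => half_recollement top.2 bot.2 top.1 bot.1
  | true => fun top bot => half_recollement top.1 bot.1 top.2 bot.2
  end.

Definition half_top (b : bool) : ladder_row U T V b -> Prop :=
  match b with
  | false => fun row => exists i e, half_recollement row.1 i row.2 e
  | true => fun row => exists l q, half_recollement row.2 l row.1 q
  end.

Lemma rows_recollement_halves (b : bool) (top : ladder_row U T V (~~ ~~ b))
    (mid : ladder_row U T V (~~ b)) (bot : ladder_row U T V b) :
  rows_recollement top mid bot <-> half_rows top mid /\ half_rows mid bot.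
Proof. by case: b top mid bot => top mid bot; apply: recollement_halves. Qed.

Section OneStep.
Variables (b : bool) (top : ladder_row U T V (~~ b)) (bot : ladder_row U T V b).
Hypothesis H : half_rows top bot.

Lemma half_rows_top : half_top top.
Proof.
by case: b top bot H => top' bot' H';
  [exists bot'.1, bot'.2|exists bot'.2, bot'.1].
Qed.

Lemma half_rows_adjoint_q : alternating_adjoint (row_q top) (row_q bot).
Proof.
by case: b top bot H => top' bot' H'; [exact: half_qi H'|exact: half_le H'].
Qed.

Lemma half_rows_adjoint_l : alternating_adjoint (row_l top) (row_l bot).
Proof.
by case: b top bot H => top' bot' H'; [exact: half_le H'|exact: half_qi H'].
Qed.

Lemma half_rows_stable : stable_t_structure (row_image top) (row_image bot).
Proof. by case: b top bot H => top' bot' H'; exact: half_stable H'. Qed.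

End OneStep.

Lemma half_rows_up_q (b : bool) (row : ladder_row U T V b) L :
  half_top row -> alternating_adjoint L (row_q row) ->
  exists top, half_rows top row.
Proof.
case: b row L => row L [f [g H]] adj.
  by have [q2 [l2 H2]] := half_up_l H (ex_intro _ L adj); exists (q2, l2).
by have [l1 [q1 H1]] := half_up_q H (ex_intro _ L adj); exists (q1, l1).
Qed.

Lemma half_rows_up_l (b : bool) (row : ladder_row U T V b) L :
  half_top row -> alternating_adjoint L (row_l row) ->
  exists top, half_rows top row.
Proof.
case: b row L => row L [f [g H]] adj.
  by have [q2 [l2 H2]] := half_up_q H (ex_intro _ L adj); exists (q2, l2).
by have [l1 [q1 H1]] := half_up_l H (ex_intro _ L adj); exists (q1, l1).
Qed.

Lemma half_rows_up_t_structure (b : bool) (row : ladder_row U T V b)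
    (X Y : T -> Prop) :
  half_top row -> stable_t_structure X Y ->
  (forall C, Y C <-> row_image row C) ->
  exists top, half_rows top row /\ forall C, X C <-> row_image top C.
Proof.
case: b row => row [f [g H]] S YE.
  by have [q2 [l2 H2]] := half_up_t_structure H S YE; exists (q2, l2).
by have [l1 [q1 H1]] := half_up_t_structure H S YE; exists (q1, l1).
Qed.

(** The two properties that climb a ladder: a left adjoint preserves coproducts,
    and it preserves compact objects if its right adjoint preserves
    coproducts. *)
Definition row_coherent (b : bool) : ladder_row U T V b -> Prop :=
  match b with
  | false => fun row =>
      [/\ preserves_compact row.1, preserves_compact row.2,
          preserves_coproducts row.1 & preserves_coproducts row.2]
  | true => fun row =>
      [/\ preserves_compact row.1, preserves_compact row.2,
          preserves_coproducts row.1 & preserves_coproducts row.2]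
  end.

Lemma half_rows_coherent (b : bool) (top : ladder_row U T V (~~ b))
    (bot : ladder_row U T V b) :
  half_rows top bot -> row_coherent bot -> row_coherent top.
Proof.
have up (C D : triangulated) (F : triangle_functor C D)
    (G : triangle_functor D C) : adjoint F G -> preserves_coproducts G ->
    preserves_compact F /\ preserves_coproducts F.
  move=> adj coG; split; last exact: adjoint_preserves_coproducts adj.
  by apply: adjoint_preserves_compact adj coG _; left;
    apply: tri_functor_additive.
case: b top bot => top bot [adj1 adj2 _ _ _] [_ _ co1 co2].
  have [? ?] := up _ _ _ _ adj1 co1; have [? ?] := up _ _ _ _ adj2 co2.
  by split.
have [? ?] := up _ _ _ _ adj1 co2; have [? ?] := up _ _ _ _ adj2 co1.
by split.
Qed.

Definition restrict_row (b : bool) : forall row : ladder_row U T V b,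
    row_coherent row -> ladder_row (compacts U) (compacts T) (compacts V) b :=
  match b with
  | false => fun row h =>
      let: And4 c1 c2 _ _ := h in (restrict_compacts c1, restrict_compacts c2)
  | true => fun row h =>
      let: And4 c1 c2 _ _ := h in (restrict_compacts c1, restrict_compacts c2)
  end.

End Rows.

Section RestrictedRows.
Variables (U T V : triangulated).

Lemma half_rows_restrict (b : bool) (top : ladder_row U T V (~~ b))
    (bot : ladder_row U T V b) (ct : row_coherent top) (cb : row_coherent bot) :
  half_rows top bot -> half_rows (restrict_row ct) (restrict_row cb).
Proof.
by case: b top bot ct cb => top bot [? ? ? ?] [? ? ? ?]; apply: half_restrict.
Qed.

Lemma row_image_restrict (b : bool) (row : ladder_row U T V b)
    (c : row_coherent row) :
  half_top row -> row_image (restrict_row c) = compact_part (row_image row).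
Proof.
move=> H; apply/funext => C; apply/propext.
case: b row c H => row [? ? ? ?] [? [? H]];
  apply: ess_image_restrict => //; exact: half_l H.
Qed.

Hypotheses (U_cg : compactly_generated U) (T_cg : compactly_generated T)
  (V_cg : compactly_generated V).

Lemma row_q_left_adjoint (b : bool) (row : ladder_row U T V b)
    (c : row_coherent row) L :
  alternating_adjoint L (row_q (restrict_row c)) ->
  exists L', alternating_adjoint L' (row_q row).
Proof.
by case: b row c L => row [c1 c2 co1 co2] L /=; apply: left_adjoint_of_compacts.
Qed.

Lemma half_rows_up_compact_t_structure (b : bool) (row : ladder_row U T V b)
    (X Y : T -> Prop) :
  half_top row -> row_coherent row ->
  stable_t_structure (compact_part X) (compact_part Y) ->
  (forall C, compact C -> Y C <-> row_image row C) ->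
  exists top, half_rows top row /\
    forall C, compact C -> X C <-> row_image top C.
Proof.
case: b row => row [f [g H]] [c1 c2 co1 co2] S YE.
  have [q2 [l2 H2]] :=
    half_up_compact_t_structure H T_cg U_cg c2 c1 co2 co1 S YE.
  by exists (q2, l2).
have [l1 [q1 H1]] := half_up_compact_t_structure H T_cg V_cg c1 c2 co1 co2 S YE.
by exists (q1, l1).
Qed.

End RestrictedRows.

Local Close Scope ring_scope.
Local Close Scope category_scope.

(** * Towers of rows *)

(** The rows of a ladder from the row [(q, l)] upwards. *)
Definition row_tower (U T V : triangulated) (q : triangle_functor T U)
    (l : triangle_functor V T) (m : nat)
    (P : forall k, ladder_row U T V (odd k)) : Prop :=
  P 0 = (q, l) /\ forall k, k < m -> half_rows (P k.+1) (P k).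

Section RowTowers.
Variables (U T V : triangulated).
Variables (q : triangle_functor T U) (i : triangle_functor U T).
Variables (l : triangle_functor V T) (e : triangle_functor T V).

(** The parity of [k.+2] is [~~ ~~ odd k], which is not convertible to [odd k];
    rows are moved along this equality by case analysis. *)
Definition lower_rows (b : bool) :
    ladder_row U T V (~~ ~~ b) -> ladder_row U T V b :=
  match b with false => id | true => id end.

Definition raise_rows (b : bool) :
    ladder_row U T V b -> ladder_row U T V (~~ ~~ b) :=
  match b with false => id | true => id end.

Lemma upward_ladderP (m : nat) (p : triangle_functor T U)
    (r : triangle_functor V T) : is_recollement q i p l e r ->
  has_upward_ladder m.+1 q i p l e r <-> exists P, row_tower q l m P.
Proof.
move=> /recollement_halves[H H0].
have half_lower (b : bool) top bot : half_rows top bot ->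
    half_rows (lower_rows (b := ~~ b) top) (lower_rows (b := b) bot).
  by case: b top bot.
have half_raise (b : bool) top bot : half_rows top bot ->
    half_rows (raise_rows (b := ~~ b) top) (raise_rows (b := b) bot).
  by case: b top bot.
split=> [[R [R0 R1 R2 RR]]|[P [P0 PP]]].
  exists (fun k => lower_rows (R k.+2)); split=> [|k km]; first by rewrite R2.
  have /rows_recollement_halves[Hk _] := RR k.+1 km.
  exact: (half_lower _ _ _ Hk).
pose R := fun j => match j return ladder_row U T V (odd j) with
  | 0 => (p, r) | 1 => (i, e) | k.+2 => raise_rows (P k) end.
exists R; split=> //.
suff HR j : j < m.+2 -> half_rows (R j.+1) (R j).
  move=> j jm; apply/rows_recollement_halves.
  by split; apply: HR => //; apply: ltnW.
case: j => [|[|k]] jm //; first by rewrite /= P0.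
exact: (half_raise _ _ _ (PP k jm)).
Qed.

Lemma tower_half_top (P : forall k, ladder_row U T V (odd k)) m k :
  half_recollement q i l e -> row_tower q l m P -> k <= m -> half_top (P k).
Proof.
move=> H [P0 PP]; case: k => [_|k km]; first by rewrite P0; exists i, e.
exact: half_rows_top (PP k km).
Qed.

(** Construction of a tower one row at a time, maintaining the invariant
    [Inv] that provides the next row. *)
Lemma row_tower_build (m : nat)
    (Inv : forall k, ladder_row U T V (odd k) -> Prop) :
  half_recollement q i l e -> Inv 0 (q, l) ->
  (forall k (row : ladder_row U T V (odd k)), k < m -> half_top row ->
     Inv k row -> exists top, half_rows top row /\ Inv k.+1 top) ->
  exists P, row_tower q l m P.
Proof.
move=> H Inv0 step.
pose default (b : bool) : ladder_row U T V b :=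
  match b with true => (i, e) | false => (q, l) end.
pose good k (row : ladder_row U T V (odd k)) := half_top row /\ Inv k row.
have next k (row : ladder_row U T V (odd k)) :
    exists top : ladder_row U T V (odd k.+1),
      k < m -> good k row -> half_rows top row /\ good k.+1 top.
  have [[km [Ht Hi]]|N] := pselect (k < m /\ good k row); last first.
    by exists (default _) => km g; case: N.
  have [top [Ht' Hi']] := step k row km Ht Hi.
  by exists top; split=> //; split=> //; apply: half_rows_top Ht'.
pose P := fix P k : ladder_row U T V (odd k) :=
  match k return ladder_row U T V (odd k) with
  | 0 => (q, l) | k.+1 => sval (cid (next k (P k))) end.
have PS k : k < m -> good k (P k) ->
    half_rows (P k.+1) (P k) /\ good k.+1 (P k.+1).
  exact: (svalP (cid (next k (P k)))).
have PG k : k <= m -> good k (P k).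
  elim: k => [_|k IH km]; first by split=> //; exists i, e.
  by have [] := PS k km (IH (ltnW km)).
by exists P; split=> // k km; have [] := PS k km (PG k (ltnW km)).
Qed.

Section BuildFrom.
Hypothesis H : half_recollement q i l e.

Lemma alternating_adjoint_transfer (C D : category) (b : bool)
    (F F' : alternating_functor C D (~~ b)) (G : alternating_functor C D b)
    (L : alternating_functor C D (~~ ~~ b)) :
  alternating_adjoint F G -> alternating_adjoint F' G ->
  alternating_adjoint L F -> alternating_adjoint L F'.
Proof. by case: b F F' G L => F F' G L /=; apply: adjoint_transfer. Qed.

(** The row [k] of the tower need not contain [s k] itself, but any two left
    adjoints of its [q]-component agree, so that [s k.+1] still is a left
    adjoint of this component. *)
Lemma row_tower_of_q_tower m s :
  left_adjoint_tower m q s -> exists P, row_tower q l m P.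
Proof.
move=> [s0 sP].
apply: (row_tower_build (Inv := fun k row =>
  k < m -> alternating_adjoint (s k.+1) (row_q row))) => //.
  by move=> m0; have := sP 0 m0; rewrite s0.
move=> k row km Ht /(_ km) adj.
have [top Htop] := half_rows_up_q Ht adj.
exists top; split=> // km'.
exact: alternating_adjoint_transfer adj (half_rows_adjoint_q Htop) (sP _ km').
Qed.

Lemma row_tower_of_l_tower m s :
  left_adjoint_tower m l s -> exists P, row_tower q l m P.
Proof.
move=> [s0 sP].
apply: (row_tower_build (Inv := fun k row =>
  k < m -> alternating_adjoint (s k.+1) (row_l row))) => //.
  by move=> m0; have := sP 0 m0; rewrite s0.
move=> k row km Ht /(_ km) adj.
have [top Htop] := half_rows_up_l Ht adj.
exists top; split=> // km'.
exact: alternating_adjoint_transfer adj (half_rows_adjoint_l Htop) (sP _ km').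
Qed.

Lemma q_tower_of_row_tower m P :
  row_tower q l m P -> left_adjoint_tower m q (fun k => row_q (P k)).
Proof.
move=> [P0 PP]; split=> [|j jm]; first by rewrite P0.
exact: half_rows_adjoint_q (PP j jm).
Qed.

Lemma l_tower_of_row_tower m P :
  row_tower q l m P -> left_adjoint_tower m l (fun k => row_l (P k)).
Proof.
move=> [P0 PP]; split=> [|j jm]; first by rewrite P0.
exact: half_rows_adjoint_l (PP j jm).
Qed.

Lemma row_tower_of_t_structures m (X : nat -> T -> Prop) :
  (forall C, X 0 C <-> ess_image l C) ->
  (forall k, k < m -> stable_t_structure (X k.+1) (X k)) ->
  exists P, row_tower q l m P.
Proof.
move=> X0 XS.
apply: (row_tower_build (Inv := fun k row =>
  forall C, X k C <-> row_image row C)) => // k row km Ht XE.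
exact: half_rows_up_t_structure Ht (XS k km) XE.
Qed.

Hypotheses (U_cg : compactly_generated U) (T_cg : compactly_generated T)
  (V_cg : compactly_generated V).
Hypothesis coh : row_coherent (b := false) (q, l).

Lemma row_tower_coherent m (P : forall k, ladder_row U T V (odd k)) k :
  row_tower q l m P -> k <= m -> row_coherent (P k).
Proof.
move=> [P0 PP]; elim: k => [_|k IH km]; first by rewrite P0.
exact: half_rows_coherent (PP k km) (IH (ltnW km)).
Qed.

Lemma row_tower_of_compact_t_structures m (X : nat -> T -> Prop) :
  (forall C, X 0 C <-> ess_image l C) ->
  (forall k, k < m ->
     stable_t_structure (compact_part (X k.+1)) (compact_part (X k))) ->
  exists P, row_tower q l m P.
Proof.
move=> X0 XS.
apply: (row_tower_build (Inv := fun k row => row_coherent row /\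
  forall C, compact C -> X k C <-> row_image row C)) => //.
move=> k row km Ht [c XE].
have [top [Htop XE']] := half_rows_up_compact_t_structure U_cg T_cg V_cg
  Ht c (XS k km) XE.
by exists top; split=> //; split=> //; apply: half_rows_coherent Htop c.
Qed.

Section CompactRows.
Variables (cq : preserves_compact q) (cl : preserves_compact l).

(** Each left adjoint on compact objects is extended to [T] and [U]; the
    restriction of the extension is again a left adjoint, so it can replace the
    given functor one row higher. *)
Lemma row_tower_of_compact_rows m Q :
  row_tower (restrict_compacts cq) (restrict_compacts cl) m Q ->
  exists P, row_tower q l m P.
Proof.
move=> [Q0 QQ]; have [_ _ coq col] := coh.
pose coh' : row_coherent (b := false) (q, l) := And4 cq cl coq col.
have QP k : k < m -> alternating_adjoint (row_q (Q k.+1)) (row_q (Q k)).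
  by move=> km; apply: half_rows_adjoint_q (QQ k km).
apply: (row_tower_build (Inv := fun k row => exists c : row_coherent row,
  k < m -> alternating_adjoint (row_q (Q k.+1)) (row_q (restrict_row c))))
  => //.
  by exists coh' => m0; have := QP 0 m0; rewrite Q0.
move=> k row km Ht [c /(_ km) adj].
have [L adjL] := row_q_left_adjoint U_cg T_cg adj.
have [top Htop] := half_rows_up_q Ht adjL.
have c' := half_rows_coherent Htop c.
exists top; split=> //; exists c' => km'.
apply: alternating_adjoint_transfer adj _ (QP _ km').
exact: half_rows_adjoint_q (half_rows_restrict c' c Htop).
Qed.

Lemma restrict_row_tower m P : 0 < m -> row_tower q l m P -> exists Q,
  row_tower (restrict_compacts cq) (restrict_compacts cl) m Q /\
  forall k, k <= m -> row_image (Q k) = compact_part (row_image (P k)).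
Proof.
move=> m_gt0 PT; have [P0 PP] := PT; have [_ _ coq col] := coh.
pose coh' : row_coherent (b := false) (q, l) := And4 cq cl coq col.
have PC k : k <= m -> row_coherent (P k) by apply: row_tower_coherent PT.
(* The rows of [P] above [m] are arbitrary and need not restrict. *)
pose default (b : bool) :
    ladder_row (compacts U) (compacts T) (compacts V) b :=
  match b with
  | true => restrict_row (PC 1 m_gt0)
  | false => restrict_row coh'
  end.
pose Q k := if pselect (row_coherent (P k)) is left c then restrict_row c
            else default (odd k).
have QE k (c : row_coherent (P k)) : Q k = restrict_row c.
  by rewrite /Q; case: pselect => // c'; rewrite (Prop_irrelevance c' c).
exists Q; split; last first.
  move=> k km; rewrite (QE k (PC k km)); apply: row_image_restrict.
  exact: tower_half_top PT km.
split=> [|k km]; last first.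
  rewrite (QE k (PC k (ltnW km))) (QE k.+1 (PC k.+1 km)).
  exact: half_rows_restrict (PP k km).
rewrite (QE 0 (PC 0 isT)); move: (PC 0 isT); rewrite P0 => c.
by rewrite (Prop_irrelevance c coh').
Qed.

End CompactRows.

End BuildFrom.

End RowTowers.

(** Here [(q, l)] is the bottom row of the recollement, which consists of the
    rows [0], [1] and [2], so that height [h.+1] reaches row [h.+2]. *)
Lemma row_tower_recollement (U T V : triangulated) (h : nat)
    (q : triangle_functor T U) (l : triangle_functor V T) :
  (exists (q2 : triangle_functor T U) (q1 : triangle_functor U T)
          (l2 : triangle_functor V T) (l1 : triangle_functor T V),
     is_recollement q2 q1 q l2 l1 l /\
     has_upward_ladder h.+1 q2 q1 q l2 l1 l) <->
  exists Q, row_tower q l h.+2 Q.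
Proof.
split=> [[q2 [q1 [l2 [l1 [_ [R [R0 R1 R2 RR]]]]]]]|[Q [Q0 QQ]]].
  exists R; split=> // k; rewrite ltnS leq_eqVlt => /orP[/eqP->|kh].
    by have /rows_recollement_halves[] := RR h (ltnSn h).
  by have /rows_recollement_halves[] := RR k kh.
have QR j : j < h.+1 -> rows_recollement (Q j.+2) (Q j.+1) (Q j).
  move=> jh; apply/rows_recollement_halves.
  by split; apply: QQ => //; apply: ltnW.
exists (Q 2).1, (Q 1).1, (Q 2).2, (Q 1).2; split.
  by have := QR 0 isT; rewrite Q0.
by exists Q; split=> //; [case: (Q 1)|case: (Q 2)].
Qed.

Lemma left_adjoint_tower_compact (C D : preadditive) (F : functor C D) m s :
  is_additive_functor F -> preserves_coproducts F -> preserves_compact F ->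
  left_adjoint_tower m F s ->
  forall j, j <= m -> alternating_preserves_compact (s j).
Proof.
move=> addF coF cF [s0 sP].
pose good b : alternating_functor C D b -> Prop := match b with
  | false => fun G => [/\ is_additive_functor G, preserves_coproducts G
                        & preserves_compact G]
  | true => fun G => [/\ is_additive_functor G, preserves_coproducts G
                        & preserves_compact G] end.
have goodS b (L : alternating_functor C D (~~ b))
    (G : alternating_functor C D b) :
    alternating_adjoint L G -> good b G -> good (~~ b) L.
  by case: b L G => L G /= adj [addG coG _]; (split;
    [exact: left_adjoint_additive adj addG
    |exact: adjoint_preserves_coproducts adj
    |apply: adjoint_preserves_compact adj coG _; right]).
have sG j : j <= m -> good (odd j) (s j).
  elim: j => [_|j IH jm]; first by rewrite /= s0.
  exact: goodS (sP j jm) (IH (ltnW jm)).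
move=> j /sG; by case: (odd j) (s j) => G [].
Qed.

Lemma t_structures_of_row_tower (U T V : triangulated) (m : nat)
    (q : triangle_functor T U) (i : triangle_functor U T)
    (p : triangle_functor T U) (l : triangle_functor V T)
    (e : triangle_functor T V) (r : triangle_functor V T) P :
  is_recollement q i p l e r -> row_tower q l m P ->
  exists X : nat -> T -> Prop,
    [/\ X 1 = ess_image r, X 2 = ess_image i,
        forall k, X k.+3 = row_image (P k)
      & forall j, 0 < j <= m.+2 -> stable_t_structure (X j.+1) (X j)].
Proof.
move=> /recollement_halves[H H0] [P0 PP].
exists (fun j => match j with
  | 0 => fun _ => True | 1 => ess_image r | 2 => ess_image i
  | k.+3 => row_image (P k) end); split=> // -[|[|[|k]]] //= km.
- exact: half_stable H0.
- by rewrite P0; apply: half_stable H.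
- exact: half_rows_stable (PP k km).
Qed.

Lemma t_structures_triangulated (T : triangulated) (X : nat -> T -> Prop) m :
  (forall j, 0 < j <= m.+2 -> stable_t_structure (X j.+1) (X j)) ->
  forall j, 0 < j <= m.+3 -> triangulated_subcategory (X j).
Proof.
move=> XS j jm; have [jm'|jm'] := leqP j m.+2.
  by case: (XS j); first lia.
have -> : j = m.+3 by lia.
by case: (XS m.+2); first lia.
Qed.

Theorem theorem3p7 (n : nat) (n_ge3 : 3 <= n) (n_odd : odd n)
    (U T V : triangulated)
    (q : triangle_functor T U) (i : triangle_functor U T)
    (p : triangle_functor T U) (l : triangle_functor V T)
    (e : triangle_functor T V) (r : triangle_functor V T)
    (U_cg : compactly_generated U) (T_cg : compactly_generated T)
    (V_cg : compactly_generated V)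
    (R : is_recollement q i p l e r) :
  [/\ [<->
        (* (i) *)
        has_upward_ladder n q i p l e r;
        (* (ii) *)
        exists s, left_adjoint_tower n.-1 q s;
        (* (iii) *)
        exists s, left_adjoint_tower n.-1 l s;
        (* (iv) *)
        let qc := restrict_compacts (recollement_q_compact R) in
        let lc := restrict_compacts (recollement_l_compact R) in
        exists (q2 : triangle_functor (compacts T) (compacts U))
               (q1 : triangle_functor (compacts U) (compacts T))
               (l2 : triangle_functor (compacts V) (compacts T))
               (l1 : triangle_functor (compacts T) (compacts V)),
          is_recollement q2 q1 qc l2 l1 lc /\
          has_upward_ladder (n - 2) q2 q1 qc l2 l1 lc;
        (* (v) *)
        exists X : nat -> T -> Prop,
          [/\ forall j, 1 <= j <= n + 2 -> triangulated_subcategory (X j),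
              forall C, X 3 C <-> ess_image l C,
              forall C, X 2 C <-> ess_image i C,
              forall C, X 1 C <-> ess_image r C
            & forall j, 1 <= j <= n -> TTF_triple (X j.+2) (X j.+1) (X j)];
        (* (vi) *)
        exists X : nat -> T -> Prop,
          [/\ forall j, 3 <= j <= n + 2 -> triangulated_subcategory (X j),
              forall C, X 3 C <-> ess_image l C
            & forall j, 3 <= j <= n ->
                TTF_triple (compact_part (X j.+2)) (compact_part (X j.+1))
                  (compact_part (X j))]],
      (* "in particular" of (ii) *)
      forall s, left_adjoint_tower n.-1 q s ->
        forall j, j < n -> alternating_preserves_compact (s j)
    & (* "in particular" of (iii) *)
      forall s, left_adjoint_tower n.-1 l s ->
        forall j, j < n -> alternating_preserves_compact (s j)].
Proof.
  (* your proof *)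

Proof.
have [h ->] : exists h, n = h.+3.
  by case: n n_ge3 {n_odd} => [|[|[|h]]] // _; exists h.
pose cq := recollement_q_compact R; pose cl := recollement_l_compact R.
have coq := adjoint_preserves_coproducts (recollement_qi R).
have col := adjoint_preserves_coproducts (recollement_le R).
have [H H0] := (recollement_halves q i l e p r).1 R.
pose coh : row_coherent (b := false) (q, l) := And4 cq cl coq col.
have ladderP := upward_ladderP h.+2 R.
split; last 2 first.
- move=> s; apply: (left_adjoint_tower_compact _ coq cq).
  exact: tri_functor_additive.
- move=> s; apply: (left_adjoint_tower_compact _ col cl).
  exact: tri_functor_additive.
tfae.
- by move=> /ladderP[P PT]; eexists; apply: q_tower_of_row_tower PT.
- move=> [s /(row_tower_of_q_tower H)[P PT]].
  by eexists; apply: l_tower_of_row_tower PT.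
- move=> [s /(row_tower_of_l_tower H)[P PT]] qc lc; rewrite !subSS subn0.
  apply/row_tower_recollement.
  have [Q [QT _]] := restrict_row_tower H coh cq cl (ltn0Sn _) PT.
  by exists Q.
- rewrite !subSS subn0 => /row_tower_recollement[Q QT].
  have [P PT] := row_tower_of_compact_rows H U_cg T_cg coh QT.
  have [X [X1 X2 X3 XS]] := t_structures_of_row_tower R PT.
  exists X; split=> [j jh|C|C|C|j jh].
  + by apply: (t_structures_triangulated XS); lia.
  + by rewrite X3 PT.1.
  + by rewrite X2.
  + by rewrite X1.
  + by split; apply: XS; lia.
- move=> [X [Xt X3 X2 X1 XT]].
  have [k kh|P PT] := row_tower_of_t_structures H (m := h.+2)
      (X := fun k => X k.+3) X3.
    by have [] := XT k.+2 _; first lia.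
  have [X' [_ _ X3' XS]] := t_structures_of_row_tower R PT.
  have [Q [[Q0 QQ] QP]] := restrict_row_tower H coh cq cl (ltn0Sn _) PT.
  have XS' j : 3 <= j <= h.+4 ->
      stable_t_structure (compact_part (X' j.+1)) (compact_part (X' j)).
    case: j => [|[|[|j]]] // jh.
    rewrite !X3' -(QP j) -?(QP j.+1); try lia.
    by apply: half_rows_stable; apply: QQ; lia.
  exists X'; split=> [j jh|C|j jh].
  + by apply: (t_structures_triangulated XS); lia.
  + by rewrite X3' PT.1.
  + by split; apply: XS'; lia.
- move=> [X [Xt X3 XT]]; apply/ladderP.
  apply: (row_tower_of_compact_t_structures H U_cg T_cg V_cg coh
    (X := fun k => X k.+3) X3) => k kh.
  (* Only the last pair of classes is the upper half of a TTF-triple. *)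
  have [k0|k0] := leqP k h; first by have [] := XT k.+3 _; first lia.
  have -> : k = h.+1 by lia.
  by have [] := XT h.+3 _; first lia.
Qed.
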